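(* For every polygraph $S$, the free complex $S^{*}$ generated by $S$ is cofibrant.
   Context: **Globular sets and complexes.** A globular set $X$ consists of sets $X_n$ ($n\ge 0$) of $n$-cells and maps $\sigma_n,\tau_n:X_{n+1}\to X_n$ (source, target) with $\sigma_n\sigma_{n+1}=\sigma_n\tau_{n+1}$ and $\tau_n\sigma_{n+1}=\tau_n\tau_{n+1}$. For $i<n$ put $\sigma_{i,n}=\sigma_i\circ\cdots\circ\sigma_{n-1}$ and $\tau_{i,n}=\tau_i\circ\cdots\circ\tau_{n-1}$. Two $n$-cells are parallel if they have the same source and the same target; any two $0$-cells are parallel. A complex is a strict $\infty$-category: a globular set $C$ with compositions $u\ast_i v\in C_n$ for $i<n$ and $u,v\in C_n$ with $\tau_{i,n}u=\sigma_{i,n}v$, and units $1_{n+1}:C_n\to C_{n+1}$, with the usual sources and targets, satisfying associativity, left and right unit laws, the exchange law $(x\ast_i y)\ast_j(z\ast_i t)=(x\ast_j z)\ast_i(y\ast_j t)$ for $i<j$, and $1_{n+1}(x\ast_i y)=1_{n+1}(x)\ast_i 1_{n+1}(y)$. Morphisms of complexes are morphisms of globular sets preserving compositions and units. $\mathbf{Compl}$ is the resulting category; its initial object $0$ is the complex with no cells. An $n$-category is the analogous structure with cells only in dimensions $\le n$. **Polygraphs and free complexes.** Given an $n$-category $C_0\Leftarrow\cdots\Leftarrow C_n$ and a set $S_{n+1}$ with maps $\sigma_n,\tau_n:S_{n+1}\to C_n$ satisfying the boundary conditions ($\sigma_n(\xi)$ and $\tau_n(\xi)$ are parallel for each $\xi\in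 S_{n+1}$), one forms the free $(n+1)$-category $C_0\Leftarrow\cdots\Leftarrow C_n\Leftarrow S_{n+1}^{*}$: it coincides with the given $n$-category up to dimension $n$, and $S_{n+1}^{*}$ consists of formal composites of elements of $S_{n+1}$ and identities on cells of $C_n$, modulo the axioms of $(n+1)$-categories. A $0$-polygraph is a set $S_0$, with $S_0^{*}=S_0$. Inductively, an $(n+1)$-polygraph is an $n$-polygraph generating a free $n$-category $S_0^{*}\Leftarrow\cdots\Leftarrow S_n^{*}$, together with a set $S_{n+1}$ and maps $\sigma_n,\tau_n:S_{n+1}\to S_n^{*}$ satisfying the boundary conditions; it generates the free $(n+1)$-category $S_0^{*}\Leftarrow\cdots\Leftarrow S_n^{*}\Leftarrow S_{n+1}^{*}$. A polygraph $S$ is an infinite sequence $S_0^{*}\Leftarrow S_1,\ S_1^{*}\Leftarrow S_2,\ldots$ whose first $n$ items define an $n$-polygraph for each $n$. The free complex it generates is $S^{*}:S_0^{*}\Leftarrow S_1^{*}\Leftarrow S_2^{*}\Leftarrow\cdots$. **Trivial fibrations and cofibrations.** Let $O[n]$ be the standard $n$-globe, the complex freely generated by the globular set with one $n$-cell, two $p$-cells for each $p<n$, and no other cells (the globular set represented by $n$). Let $\partial O[n]$ be the subcomplex generated by the cells of dimension $<n$, and $\mathrm{i}_n:\partial O[n]\to O[n]$ the inclusion. Thus morphisms $O[n]\to C$ correspond to $n$-cells of $C$, and for $n\ge1$ morphisms $\partial O[n]\to C$ correspond to ordered pairs of parallel $(n-1)$-cells; $\partial O[0]=0$. A morphism $f:A\to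 B$ is left-orthogonal to $g:C\to D$, and $g$ is right-orthogonal to $f$, if for all $u:A\to C$, $v:B\to D$ with $g\circ u=v\circ f$ there exists $h:B\to C$ with $h\circ f=u$ and $g\circ h=v$. A trivial fibration is a morphism of $\mathbf{Compl}$ right-orthogonal to all $\mathrm{i}_n$, $n\ge 0$. A cofibration is a morphism left-orthogonal to all trivial fibrations. A complex $C$ is cofibrant if the unique morphism $0\to C$ is a cofibration. *)

(* Defs.v *)
From mathcomp Require Import all_boot.
From mathcomp Require Import boolp.

Set Implicit Arguments.
Unset Strict Implicit.
Unset Printing Implicit Defensive.

(* [idx n] is {0, ..., n-1} and [ival] its inclusion into nat.  It is coded as
   an iterated option type, instead of 'I_n, so that the iterated source and
   target maps below, whose codomain depends on the index, compute. *)
Fixpoint idx (n : nat) : Type := if n is n'.+1 then option (idx n') else Empty_set.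

Definition itop n : idx n.+1 := None.
Definition iup n (p : idx n) : idx n.+1 := Some p.

Fixpoint ival n : idx n -> nat :=
  match n return idx n -> nat with
  | 0 => fun p => match p with end
  | n'.+1 => fun p => match p with None => n' | Some q => ival q end
  end.

Lemma ival_lt n (p : idx n) : ival p < n.
Proof. by elim: n p => [[]|n IH [q|]] //=; rewrite ltnS ltnW. Qed.

Record globular := Globular {
  gcell :> nat -> Type;
  src : forall k, gcell k.+1 -> gcell k;
  tgt : forall k, gcell k.+1 -> gcell k;
  src_src : forall k (x : gcell k.+2), src (src x) = src (tgt x);
  tgt_src : forall k (x : gcell k.+2), tgt (src x) = tgt (tgt x) }.
Arguments src {g k} : rename.
Arguments tgt {g k} : rename.

Fixpoint isrc (X : globular) n : forall p : idx n, X n -> X (ival p) :=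
  match n return forall p : idx n, X n -> X (ival p) with
  | 0 => fun p => match p with end
  | n'.+1 => fun p x =>
      match p return X (@ival n'.+1 p) with
      | None => src x
      | Some q => isrc q (src x)
      end
  end.

Fixpoint itgt (X : globular) n : forall p : idx n, X n -> X (ival p) :=
  match n return forall p : idx n, X n -> X (ival p) with
  | 0 => fun p => match p with end
  | n'.+1 => fun p x =>
      match p return X (@ival n'.+1 p) with
      | None => tgt x
      | Some q => itgt q (tgt x)
      end
  end.

Definition parallel (X : globular) n : X n -> X n -> Prop :=
  match n return X n -> X n -> Prop with
  | 0 => fun _ _ => True
  | n'.+1 => fun x y => src x = src y /\ tgt x = tgt y
  end.

(* [Some n] stands for the dimension bound n, [None] for no bound. *)
Definition within (N : option nat) (k : nat) : bool :=
  if N is Some n then k <= n else true.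

Lemma within_pred N k : within N k.+1 -> within N k.
Proof. by case: N => //= n; apply: ltnW. Qed.

(* [comp p u v] is the composite of u and v, in diagrammatic order, along their
   common boundary cell of dimension [ival p]. *)
Record cat_data (N : option nat) := CatData {
  cglob :> globular;
  comp : forall k (p : idx k) (u v : cglob k), itgt p u = isrc p v -> cglob k;
  idc : forall k, within N k.+1 -> cglob k -> cglob k.+1 }.
Arguments comp {N c k} p u v _ : rename.
Arguments idc {N c k} _ _ : rename.

Fixpoint iidc N (C : cat_data N) k :
    forall p : idx k, within N k -> C (ival p) -> C k :=
  match k return forall p : idx k, within N k -> C (ival p) -> C k with
  | 0 => fun p => match p with end
  | k'.+1 => fun p =>
      match p return within N k'.+1 -> C (@ival k'.+1 p) -> C k'.+1 with
      | None => fun h x => idc h x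
      | Some q => fun h x => idc h (@iidc N C k' q (within_pred h) x)
      end
  end.
Arguments iidc {N C k} p _ _ : rename.

(* The laws are quantified over all proofs of composability, so that each of
   them holds as soon as both of its sides are defined. *)
Record cat_axioms N (C : cat_data N) : Prop := CatAxioms {
  cell_within : forall k, C k -> within N k;
  src_idc : forall k h (x : C k), src (idc h x) = x;
  tgt_idc : forall k h (x : C k), tgt (idc h x) = x;
  src_comp_top : forall k (u v : C k.+1) e, src (comp (itop k) u v e) = src u;
  tgt_comp_top : forall k (u v : C k.+1) e, tgt (comp (itop k) u v e) = tgt v;
  src_comp_up : forall k (p : idx k) (u v : C k.+1) e e',
    src (comp (iup p) u v e) = comp p (src u) (src v) e';
  tgt_comp_up : forall k (p : idx k) (u v : C k.+1) e e',
    tgt (comp (iup p) u v e) = comp p (tgt u) (tgt v) e';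
  compA : forall k (p : idx k) (u v w : C k) e1 e2 e3 e4,
    comp p (comp p u v e1) w e2 = comp p u (comp p v w e3) e4;
  comp_idl : forall k (p : idx k) h (u : C k) e,
    comp p (iidc p h (isrc p u)) u e = u;
  comp_idr : forall k (p : idx k) h (u : C k) e,
    comp p u (iidc p h (itgt p u)) e = u;
  exchange : forall k (p q : idx k) (x y z t : C k) e1 e2 e3 e4 e5 e6,
    ival p < ival q ->
    comp q (comp p x y e1) (comp p z t e2) e3 =
    comp p (comp q x z e4) (comp q y t e5) e6;
  idc_comp : forall k h (p : idx k) (x y : C k) e e',
    idc h (comp p x y e) = comp (iup p) (idc h x) (idc h y) e' }.

Record cat (N : option nat) := Cat {
  cdata :> cat_data N;
  catP : cat_axioms cdata }.

Definition ncat (n : nat) := cat (Some n).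
Definition complex := cat None.

Record mor (A B : complex) := Mor {
  mfun :> forall k, A k -> B k;
  mor_src : forall k (x : A k.+1), mfun (src x) = src (mfun x);
  mor_tgt : forall k (x : A k.+1), mfun (tgt x) = tgt (mfun x);
  mor_idc : forall k h (x : A k), mfun (idc h x) = idc h (mfun x);
  mor_comp : forall k (p : idx k) (u v : A k) e e',
    mfun (comp p u v e) = comp p (mfun u) (mfun v) e' }.
Arguments mor_comp {A B} m {k p u v} e e' : rename.

Lemma comp_eq N (C : cat_data N) k (p : idx k) (u u' v v' : C k) e e' :
  u = u' -> v = v' -> comp p u v e = comp p u' v' e'.
Proof. by move=> hu hv; subst u' v'; congr comp; apply: Prop_irrelevance. Qed.

Lemma idc_eq N (C : cat_data N) k h h' (x x' : C k) :
  x = x' -> idc h x = idc h' x'.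
Proof. by move->; congr idc; apply: Prop_irrelevance. Qed.

Lemma iidc_eq N (C : cat_data N) k (p : idx k) h h' (x x' : C (ival p)) :
  x = x' -> iidc p h x = iidc p h' x'.
Proof. by move->; congr iidc; apply: Prop_irrelevance. Qed.

Lemma isrc_par (X : globular) n (p : idx n) (x y : X n) :
  parallel x y -> isrc p x = isrc p y.
Proof. by case: n p x y => [[]|n [q|]] x y [] //= -> _. Qed.

Lemma itgt_par (X : globular) n (p : idx n) (x y : X n) :
  parallel x y -> itgt p x = itgt p y.
Proof. by case: n p x y => [[]|n [q|]] x y [] //= _ ->. Qed.

Lemma par_refl (X : globular) n (x : X n) : parallel x x.
Proof. by case: n x. Qed.

Lemma comp_idl' N (C : cat N) k (p : idx k) h x (u : C k) e :
  x = isrc p u -> comp p (iidc p h x) u e = u.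
Proof. by move=> hx; subst x; apply: (comp_idl (catP C)). Qed.

Lemma comp_idr' N (C : cat N) k (p : idx k) h x (u : C k) e :
  x = itgt p u -> comp p u (iidc p h x) e = u.
Proof. by move=> hx; subst x; apply: (comp_idr (catP C)). Qed.

Lemma par_src_tgt (X : globular) n (x : X n.+1) : parallel (src x) (tgt x).
Proof. by case: n x => [|n] x //=; rewrite src_src tgt_src. Qed.

Lemma par_trans (X : globular) n (x y z : X n) :
  parallel x y -> parallel y z -> parallel x z.
Proof. by case: n x y z => [|n] x y z //= [-> ->]. Qed.

Lemma par_comp N (C : cat N) n (p : idx n) (x x' y y' : C n) e e' :
  parallel x y -> parallel x' y' ->
  parallel (comp p x x' e) (comp p y y' e').
Proof.
case: n p x x' y y' e e' => [[]|n [q|]] x x' y y' /= e e' [h1 h2] [h3 h4].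
- have e1 : itgt q (src x) = isrc q (src x').
    by rewrite (itgt_par _ (par_src_tgt x)) e.
  have e2 : itgt q (src y) = isrc q (src y').
    by rewrite (itgt_par _ (par_src_tgt y)) e'.
  have e3 : itgt q (tgt x) = isrc q (tgt x').
    by rewrite -(isrc_par _ (par_src_tgt x')) e.
  have e4 : itgt q (tgt y) = isrc q (tgt y').
    by rewrite -(isrc_par _ (par_src_tgt y')) e'.
  split.
    rewrite (src_comp_up (catP C) _ e1) (src_comp_up (catP C) _ e2).
    exact: comp_eq.
  rewrite (tgt_comp_up (catP C) _ e3) (tgt_comp_up (catP C) _ e4).
  exact: comp_eq.
- by rewrite !(src_comp_top (catP C)) !(tgt_comp_top (catP C)).
Qed.

Lemma mor_isrc (A B : complex) (f : mor A B) k (p : idx k) (x : A k) :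
  f _ (isrc p x) = isrc p (f _ x).
Proof.
by elim: k p x => [[]|k IH [q|]] x /=; rewrite ?IH mor_src.
Qed.

Lemma mor_itgt (A B : complex) (f : mor A B) k (p : idx k) (x : A k) :
  f _ (itgt p x) = itgt p (f _ x).
Proof.
by elim: k p x => [[]|k IH [q|]] x /=; rewrite ?IH mor_tgt.
Qed.

Lemma mor_ext (A B : complex) (f g : mor A B) :
  (forall k (x : A k), f k x = g k x) -> f = g.
Proof.
case: f g => [f a1 a2 a3 a4] [g b1 b2 b3 b4] /= h.
have hfg : f = g by apply: functional_extensionality_dep => k; apply: funext.
by subst g; congr Mor; apply: Prop_irrelevance.
Qed.

Definition mcomp (A B C : complex) (g : mor B C) (f : mor A B) : mor A C.
Proof.
apply: (@Mor A C (fun k x => g k (f k x))) => [k x|k x|k h x|k p u v e e'].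
- by rewrite !mor_src.
- by rewrite !mor_tgt.
- by rewrite !mor_idc.
- have e1 : itgt p (f k u) = isrc p (f k v) by rewrite -mor_itgt e mor_isrc.
  by rewrite (mor_comp f e e1) (mor_comp g e1 e').
Defined.

Lemma sig_eq (T : Type) (P : T -> Prop) (u v : {x | P x}) :
  proj1_sig u = proj1_sig v -> u = v.
Proof.
case: u v => [x hx] [y hy] /= h; subst y.
by congr exist; apply: Prop_irrelevance.
Qed.

Section Quotient.
Variables (T : Type) (R : T -> T -> Prop).
Hypothesis R_refl : forall x, R x x.
Hypothesis R_sym : forall x y, R x y -> R y x.
Hypothesis R_trans : forall x y z, R x y -> R y z -> R x z.

Definition quot : Type := {P : T -> Prop | exists x, P = R x}.
Definition cls (x : T) : quot := exist _ (R x) (ex_intro _ x erefl).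
Definition repr (c : quot) : T := projT1 (cid (proj2_sig c)).

Lemma cls_eq x y : R x y -> cls x = cls y.
Proof.
move=> h; apply: sig_eq; apply: funext => z; apply: propext; split => h'.
  by apply: R_trans h'; apply: R_sym.
exact: R_trans h h'.
Qed.

Lemma cls_inj x y : cls x = cls y -> R x y.
Proof. by move=> /(f_equal (@proj1_sig _ _)) /= ->. Qed.

Lemma reprK c : cls (repr c) = c.
Proof. by apply: sig_eq; rewrite /repr; case: cid => x /= ->. Qed.

Lemma repr_cls x : R (repr (cls x)) x.
Proof. by apply: cls_inj; rewrite reprK. Qed.
End Quotient.

Section FreeExtension.
Variables (n : nat) (C : ncat n) (S : Type) (s t : S -> C n).

(* Formal composites of generators and identities, indexed by their source and
   target.  [ecomp_up] composes along dimensions below n; there the boundary is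
   composed in C. *)
Inductive expr : C n -> C n -> Type :=
| egen (a : S) : expr (s a) (t a)
| eidc (c : C n) : expr c c
| ecomp_top x y y' z (e : y = y') : expr x y -> expr y' z -> expr x z
| ecomp_up (p : idx n) x y x' y'
    (es : itgt p x = isrc p x') (et : itgt p y = isrc p y') :
    expr x y -> expr x' y' -> expr (comp p x x' es) (comp p y y' et).

Record pcell := Pcell { psrc : C n; ptgt : C n; pexpr : expr psrc ptgt }.

Definition pgen (a : S) : pcell := Pcell (egen a).
Definition pidc (c : C n) : pcell := Pcell (eidc c).

Definition pisrc (p : idx n.+1) (a : pcell) : C (ival p) :=
  match p return C (@ival n.+1 p) with
  | None => psrc a
  | Some q => isrc q (psrc a)
  end.

Definition pitgt (p : idx n.+1) (a : pcell) : C (ival p) :=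
  match p return C (@ival n.+1 p) with
  | None => ptgt a
  | Some q => itgt q (ptgt a)
  end.

Definition piidc (p : idx n.+1) : C (ival p) -> pcell :=
  match p return C (@ival n.+1 p) -> pcell with
  | None => pidc
  | Some q => fun x => pidc (@iidc _ C n q (leqnn n) x)
  end.

Hypothesis st_par : forall a, parallel (s a) (t a).

Lemma expr_par x y : expr x y -> parallel x y.
Proof.
elim=> {x y} [a|c|x y y' z -> _ h1 _ h2|p x y x' y' es et _ h1 _ h2] //.
- exact: par_refl.
- exact: par_trans h2.
- exact: par_comp.
Qed.

Lemma pcell_par (a : pcell) : parallel (psrc a) (ptgt a).
Proof. exact: expr_par (pexpr a). Qed.

Lemma up_es (p : idx n) (a b : pcell) :
  itgt p (ptgt a) = isrc p (psrc b) -> itgt p (psrc a) = isrc p (psrc b).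
Proof. by rewrite (itgt_par p (pcell_par a)). Qed.

Lemma up_et (p : idx n) (a b : pcell) :
  itgt p (ptgt a) = isrc p (psrc b) -> itgt p (ptgt a) = isrc p (ptgt b).
Proof. by rewrite (isrc_par p (pcell_par b)). Qed.

Definition pcomp (p : idx n.+1) (a b : pcell) :
    pitgt p a = pisrc p b -> pcell :=
  match p return pitgt p a = pisrc p b -> pcell with
  | None => fun e => Pcell (ecomp_top e (pexpr a) (pexpr b))
  | Some q => fun e =>
      Pcell (ecomp_up (up_es e) (up_et e) (pexpr a) (pexpr b))
  end.

Inductive eqv : pcell -> pcell -> Prop :=
| eqv_refl a : eqv a a
| eqv_sym a b : eqv a b -> eqv b a
| eqv_trans a b c : eqv a b -> eqv b c -> eqv a c
| eqv_comp p a a' b b' e e' :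
    eqv a a' -> eqv b b' -> eqv (@pcomp p a b e) (@pcomp p a' b' e')
| eqv_compA p a b c e1 e2 e3 e4 :
    eqv (@pcomp p (@pcomp p a b e1) c e2) (@pcomp p a (@pcomp p b c e3) e4)
| eqv_comp_idl p a e : eqv (@pcomp p (piidc (pisrc p a)) a e) a
| eqv_comp_idr p a e : eqv (@pcomp p a (piidc (pitgt p a)) e) a
| eqv_exchange p q a b c d e1 e2 e3 e4 e5 e6 :
    ival p < ival q ->
    eqv (@pcomp q (@pcomp p a b e1) (@pcomp p c d e2) e3)
        (@pcomp p (@pcomp q a c e4) (@pcomp q b d e5) e6)
| eqv_idc_comp (p : idx n) x y e e' :
    eqv (pidc (comp p x y e)) (@pcomp (iup p) (pidc x) (pidc y) e').

Lemma eqv_bd a b : eqv a b -> psrc a = psrc b /\ ptgt a = ptgt b.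
Proof.
elim=> {a b} [a|a b _ [-> ->]|a b c _ [-> ->] _ [-> ->]|
  [p|] a a' b b' e e' _ [h1 h2] _ [h3 h4]|[p|] a b c e1 e2 e3 e4|
  [p|] a e|[p|] a e|
  [p|] [q|] a b c d e1 e2 e3 e4 e5 e6 /= hpq|p x y e e'] //=.
- by split; apply: comp_eq.
- by split; apply: (compA (catP C)).
- by split; apply: comp_idl' => //; apply: isrc_par (pcell_par a).
- by split; apply: comp_idr' => //; symmetry; apply: itgt_par (pcell_par a).
- by split; apply: (exchange (catP C)).
- by split; apply: comp_eq.
- by move: hpq; rewrite ltnNge ltnW ?ival_lt.
- by split; apply: comp_eq.
Qed.

Definition scell : Type := quot eqv.

Notation rep := (@repr _ eqv).
Notation scls := (cls eqv).

Lemma scls_eq a b : eqv a b -> scls a = scls b.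
Proof. exact: (cls_eq eqv_sym eqv_trans). Qed.

Lemma rep_scls a : eqv (rep (scls a)) a.
Proof. exact: (repr_cls eqv_refl). Qed.

Lemma pisrc_eqv p a b : eqv a b -> pisrc p a = pisrc p b.
Proof. by move=> /eqv_bd[h1 h2]; case: p => [q|] /=; rewrite h1. Qed.

Lemma pitgt_eqv p a b : eqv a b -> pitgt p a = pitgt p b.
Proof. by move=> /eqv_bd[h1 h2]; case: p => [q|] /=; rewrite h2. Qed.

(* Cells of the free extension; as [C] has no cell above dimension n,
   [xnew] accounts for all the cells of dimension n.+1. *)
Inductive xcell : nat -> Type :=
| xold k (c : C k) : xcell k
| xnew (c : scell) : xcell n.+1.

(* Return type of matches on [xcell m] where m is known to be a successor. *)
Definition at_pred (X : nat -> Type) (m : nat) : Type :=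
  if m is k.+1 then X k else unit.

Definition xsrc k (x : xcell k.+1) : xcell k :=
  match x in xcell m return at_pred xcell m with
  | xold m c =>
      match m return C m -> at_pred xcell m with
      | 0 => fun _ => tt
      | k'.+1 => fun c => xold (src c)
      end c
  | xnew c => xold (psrc (rep c))
  end.

Definition xtgt k (x : xcell k.+1) : xcell k :=
  match x in xcell m return at_pred xcell m with
  | xold m c =>
      match m return C m -> at_pred xcell m with
      | 0 => fun _ => tt
      | k'.+1 => fun c => xold (tgt c)
      end c
  | xnew c => xold (ptgt (rep c))
  end.

Lemma no_cell k : C k -> n < k -> False.
Proof. by move=> /(cell_within (catP C)) /= h; rewrite ltnNge h. Qed.

Lemma ltnn_False m : m < m -> False.
Proof. by rewrite ltnn. Qed.

Definition xo k (x : xcell k) : k <= n -> C k :=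
  match x in xcell k return k <= n -> C k with
  | xold _ c => fun _ => c
  | xnew _ => fun h => False_rect _ (ltnn_False h)
  end.

Definition xn m (x : xcell m) : m = n.+1 -> scell :=
  match x in xcell m return m = n.+1 -> scell with
  | xold k c => fun e =>
      False_rect _ (no_cell c (eq_ind_r (fun m => n < m) (ltnSn n) e))
  | xnew c => fun _ => c
  end.

Lemma xoK k (x : xcell k) h : xold (xo x h) = x.
Proof. by case: x h => [//|c] h; exfalso; rewrite ltnn in h. Qed.

Lemma xnK (x : xcell n.+1) : xnew (xn x erefl) = x.
Proof.
suff H m (y : xcell m) (e : m = n.+1) : xnew (xn y e) = eq_rect m xcell y _ e.
  exact: (H _ x erefl).
case: y e => [k c|c] e; last by rewrite (eq_irrelevance e erefl).
by exfalso; apply: (no_cell c); rewrite e.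
Qed.

Lemma xold_inj k (a b : C k) : xold a = xold b -> a = b.
Proof.
move=> e; have h : k <= n := cell_within (catP C) a.
exact: (f_equal (fun x => xo x h) e).
Qed.

Lemma xlowP k (x : xcell k) : k <= n -> exists c, x = xold c.
Proof. by move=> h; exists (xo x h); rewrite xoK. Qed.

Lemma xtopP (x : xcell n.+1) : exists a, x = xnew (scls a).
Proof. by exists (rep (xn x erefl)); rewrite reprK xnK. Qed.

Lemma xdimP k (x : xcell k) : k <= n \/ k = n.+1.
Proof. by case: x => [m c|]; [left; apply: (cell_within (catP C))|right]. Qed.

Lemma xglob_axiom k (x : xcell k.+2) :
  xsrc (xsrc x) = xsrc (xtgt x) /\ xtgt (xsrc x) = xtgt (xtgt x).
Proof.
pose par m : xcell m -> xcell m -> Prop :=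
  if m is m'.+1 then fun x y => xsrc x = xsrc y /\ xtgt x = xtgt y
  else fun _ _ => True.
have parP m (a b : C m) : parallel a b -> par m (xold a) (xold b).
  by case: m a b => [//|m] a b /= [-> ->].
pose Q m : xcell m -> Prop :=
  if m is m'.+1 then fun x => par m' (xsrc x) (xtgt x) else fun _ => True.
suff H m (y : xcell m) : Q m y by exact: (H _ x).
case: y => [m' c|c]; last by apply: parP; apply: pcell_par.
by case: m' c => [//|m'] c; apply: parP; apply: par_src_tgt.
Qed.

Definition xglob : globular :=
  @Globular xcell xsrc xtgt
    (fun k x => proj1 (xglob_axiom x)) (fun k x => proj2 (xglob_axiom x)).

Lemma xisrc_old k (p : idx k) (c : C k) :
  @isrc xglob k p (xold c) = xold (isrc p c).
Proof. by elim: k p c => [[]|k IH [q|]] c //=; rewrite IH. Qed.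

Lemma xitgt_old k (p : idx k) (c : C k) :
  @itgt xglob k p (xold c) = xold (itgt p c).
Proof. by elim: k p c => [[]|k IH [q|]] c //=; rewrite IH. Qed.

Lemma xisrc_new p c : @isrc xglob n.+1 p (xnew c) = xold (pisrc p (rep c)).
Proof. by case: p => [q|] //=; rewrite xisrc_old. Qed.

Lemma xitgt_new p c : @itgt xglob n.+1 p (xnew c) = xold (pitgt p (rep c)).
Proof. by case: p => [q|] //=; rewrite xitgt_old. Qed.

Lemma xcomp_pf_old k (p : idx k) (c : C k) (v : xcell k) h :
  @itgt xglob k p (xold c) = @isrc xglob k p v ->
  itgt p c = isrc p (xo v h).
Proof.
move=> e; apply: xold_inj.
by rewrite -xitgt_old e -{1}(xoK v h) xisrc_old.
Qed.

Lemma xcomp_pf_new (p : idx n.+1) (c : scell) (v : xcell n.+1) :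
  @itgt xglob n.+1 p (xnew c) = @isrc xglob n.+1 p v ->
  pitgt p (rep c) = pisrc p (rep (xn v erefl)).
Proof.
by move=> e; apply: xold_inj; rewrite -xitgt_new e -{1}(xnK v) xisrc_new.
Qed.

Definition xcomp k (p : idx k) (u v : xglob k) :
    itgt p u = isrc p v -> xglob k :=
  match u in xcell k return
    forall (p : idx k) (v : xcell k),
      @itgt xglob k p u = @isrc xglob k p v -> xcell k with
  | xold k c => fun p v e =>
      let h : k <= n := cell_within (catP C) c in
      xold (comp p c (xo v h) (@xcomp_pf_old k p c v h e))
  | xnew c => fun p v e => xnew (scls (@pcomp p (rep c) (rep (xn v erefl)) (xcomp_pf_new e)))
  end p v.

Definition ltn_dec k m : {k < m} + {~~ (k < m)}.
Proof. by case: (boolP (k < m)); [left|right]. Defined.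

Lemma idtop_pf k : ~~ (k < n) -> k < n.+1 -> n = k.
Proof.
by rewrite ltnS -leqNgt => h1 h2; apply/eqP; rewrite eqn_leq h1.
Qed.

Definition xidtop k (e : n = k) : C k -> xcell k.+1 :=
  match e in _ = k return C k -> xcell k.+1 with
  | erefl => fun c => xnew (scls (pidc c))
  end.

Definition xidc k (h : within (Some n.+1) k.+1) (x : xglob k) : xglob k.+1 :=
  match x in xcell k return within (Some n.+1) k.+1 -> xcell k.+1 with
  | xold k c => fun h =>
      match ltn_dec k n with
      | left h' => xold (@idc _ C k h' c)
      | right h' => xidtop (idtop_pf h' h) c
      end
  | xnew c => fun h => False_rect _ (ltnn_False h)
  end h.

Definition ext_data : cat_data (Some n.+1) := CatData xcomp xidc.

Lemma xcomp_old k (p : idx k) (a b : C k) e e' :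
  @comp _ ext_data k p (xold a) (xold b) e = xold (comp p a b e').
Proof. by congr xold; apply: comp_eq. Qed.

Lemma xcomp_new p (a b : pcell) e e' :
  @comp _ ext_data n.+1 p (xnew (scls a)) (xnew (scls b)) e =
  xnew (scls (@pcomp p a b e')).
Proof.
by congr xnew; apply: scls_eq; apply: eqv_comp; apply: rep_scls.
Qed.

Lemma xidc_old k h h' (c : C k) :
  @idc _ ext_data k h (xold c) = xold (@idc _ C k h' c).
Proof.
rewrite /= /xidc; case: ltn_dec => [h''|h''].
  by congr xold; apply: idc_eq.
by exfalso; move: h'; rewrite /= (negbTE h'').
Qed.

Lemma xidc_new h (c : C n) : @idc _ ext_data n h (xold c) = xnew (scls (pidc c)).
Proof.
rewrite /= /xidc; case: ltn_dec => [h''|h''].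
  by exfalso; rewrite ltnn in h''.
by rewrite (eq_irrelevance (idtop_pf h'' h) erefl).
Qed.

Lemma xiidc_old k (p : idx k) h h' (x : C (ival p)) :
  @iidc _ ext_data k p h (xold x) = xold (@iidc _ C k p h' x).
Proof.
elim: k p h h' x => [[]|k IH [q|]] h h' x /=; last exact: xidc_old.
rewrite (IH _ _ (ltnW h')); apply: etrans (xidc_old _ h' _) _.
by congr xold; apply: idc_eq; apply: iidc_eq.
Qed.

Lemma xiidc_new (p : idx n.+1) h (x : C (ival p)) :
  @iidc _ ext_data n.+1 p h (xold x) = xnew (scls (@piidc p x)).
Proof.
case: p x => [q|] x /=; last exact: xidc_new.
by rewrite (xiidc_old _ (leqnn n)); apply: xidc_new.
Qed.

Lemma xnew_src a : @src xglob n (xnew (scls a)) = xold (psrc a).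
Proof. by rewrite /= (proj1 (eqv_bd (rep_scls a))). Qed.

Lemma xnew_tgt a : @tgt xglob n (xnew (scls a)) = xold (ptgt a).
Proof. by rewrite /= (proj2 (eqv_bd (rep_scls a))). Qed.

Lemma xold_e k (p : idx k) (a b : C k) :
  @itgt xglob k p (xold a) = @isrc xglob k p (xold b) -> itgt p a = isrc p b.
Proof. by rewrite xitgt_old xisrc_old => /xold_inj. Qed.

Lemma xnew_e p (a b : pcell) :
  @itgt xglob n.+1 p (xnew (scls a)) = @isrc xglob n.+1 p (xnew (scls b)) ->
  pitgt p a = pisrc p b.
Proof.
rewrite xitgt_new xisrc_new => /xold_inj.
by rewrite (pitgt_eqv _ (rep_scls a)) (pisrc_eqv _ (rep_scls b)).
Qed.

Lemma ext_axioms : cat_axioms ext_data.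
Proof.
split.
- by move=> k /xdimP /= [/leqW|->].
- move=> k h x; have [h1|h1] := ltnP k n.
    have [c ->] := xlowP x (ltnW h1).
    by rewrite (xidc_old _ h1) /= (src_idc (catP C)).
  have e : k = n by apply/eqP; rewrite eqn_leq h1 andbT; apply: h.
  subst k; have [c ->] := xlowP x (leqnn n).
  by rewrite xidc_new; apply: xnew_src.
- move=> k h x; have [h1|h1] := ltnP k n.
    have [c ->] := xlowP x (ltnW h1).
    by rewrite (xidc_old _ h1) /= (tgt_idc (catP C)).
  have e : k = n by apply/eqP; rewrite eqn_leq h1 andbT; apply: h.
  subst k; have [c ->] := xlowP x (leqnn n).
  by rewrite xidc_new; apply: xnew_tgt.
- move=> k u v; case: (xdimP u) => [h|[e]].
    have [a ->] := xlowP u h; have [b ->] := xlowP v h => e.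
    by rewrite (xcomp_old _ (xold_e e)) /= (src_comp_top (catP C)).
  subst k; have [a ->] := xtopP u; have [b ->] := xtopP v => e.
  by rewrite (xcomp_new _ (xnew_e e)) !xnew_src.
- move=> k u v; case: (xdimP u) => [h|[e]].
    have [a ->] := xlowP u h; have [b ->] := xlowP v h => e.
    by rewrite (xcomp_old _ (xold_e e)) /= (tgt_comp_top (catP C)).
  subst k; have [a ->] := xtopP u; have [b ->] := xtopP v => e.
  by rewrite (xcomp_new _ (xnew_e e)) !xnew_tgt.
- move=> k p u v; case: (xdimP u) => [h|[e]].
    have [a ->] := xlowP u h; have [b ->] := xlowP v h => e e'.
    rewrite (xcomp_old _ (xold_e e)).
    rewrite [RHS](xcomp_old _ (xold_e e')).
    by rewrite -(src_comp_up (catP C) (xold_e e)).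
  subst k; have [a ->] := xtopP u; have [b ->] := xtopP v => e.
  rewrite (xcomp_new _ (xnew_e e)) !xnew_src => e'.
  by rewrite (xcomp_old _ (up_es (xnew_e e))).
- move=> k p u v; case: (xdimP u) => [h|[e]].
    have [a ->] := xlowP u h; have [b ->] := xlowP v h => e e'.
    rewrite (xcomp_old _ (xold_e e)).
    rewrite [RHS](xcomp_old _ (xold_e e')).
    by rewrite -(tgt_comp_up (catP C) (xold_e e)).
  subst k; have [a ->] := xtopP u; have [b ->] := xtopP v => e.
  rewrite (xcomp_new _ (xnew_e e)) !xnew_tgt => e'.
  by rewrite (xcomp_old _ (up_et (xnew_e e))).
- move=> k p u v w; case: (xdimP u) => [h|e].
    have [a ->] := xlowP u h; have [b ->] := xlowP v h.
    have [c ->] := xlowP w h => e1 e2 e3 e4; move: e2 e4.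
    rewrite (xcomp_old _ (xold_e e1)) (xcomp_old _ (xold_e e3)) => e2 e4.
    rewrite (xcomp_old _ (xold_e e2)) (xcomp_old _ (xold_e e4)).
    by congr xold; apply: (compA (catP C)).
  subst k; have [a ->] := xtopP u; have [b ->] := xtopP v.
  have [c ->] := xtopP w => e1 e2 e3 e4; move: e2 e4.
  rewrite (xcomp_new _ (xnew_e e1)) (xcomp_new _ (xnew_e e3)) => e2 e4.
  rewrite (xcomp_new _ (xnew_e e2)) (xcomp_new _ (xnew_e e4)).
  by congr xnew; apply: scls_eq; apply: eqv_compA.
- move=> k p h u; case: (xdimP u) => [h1|e].
    have [a ->] := xlowP u h1.
    have -> : @iidc _ ext_data _ p h (@isrc xglob k p (xold a)) =
              xold (@iidc _ C k p h1 (isrc p a)).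
      by rewrite xisrc_old; apply: xiidc_old.
    move=> e.
    by rewrite (xcomp_old _ (xold_e e)); congr xold; apply: (comp_idl (catP C)).
  subst k; have [a ->] := xtopP u.
  have -> : @iidc _ ext_data _ p h (@isrc xglob n.+1 p (xnew (scls a))) =
            xnew (scls (piidc (pisrc p a))).
    by rewrite xisrc_new (pisrc_eqv _ (rep_scls a)); apply: xiidc_new.
  move=> e.
  rewrite (xcomp_new _ (xnew_e e)).
  by congr xnew; apply: scls_eq; apply: eqv_comp_idl.
- move=> k p h u; case: (xdimP u) => [h1|e].
    have [a ->] := xlowP u h1.
    have -> : @iidc _ ext_data _ p h (@itgt xglob k p (xold a)) =
              xold (@iidc _ C k p h1 (itgt p a)).
      by rewrite xitgt_old; apply: xiidc_old.
    move=> e.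
    by rewrite (xcomp_old _ (xold_e e)); congr xold; apply: (comp_idr (catP C)).
  subst k; have [a ->] := xtopP u.
  have -> : @iidc _ ext_data _ p h (@itgt xglob n.+1 p (xnew (scls a))) =
            xnew (scls (piidc (pitgt p a))).
    by rewrite xitgt_new (pitgt_eqv _ (rep_scls a)); apply: xiidc_new.
  move=> e.
  rewrite (xcomp_new _ (xnew_e e)).
  by congr xnew; apply: scls_eq; apply: eqv_comp_idr.
- move=> k p q x y z w; case: (xdimP x) => [h|e].
    have [a ->] := xlowP x h; have [b ->] := xlowP y h.
    have [c ->] := xlowP z h; have [d ->] := xlowP w h.
    move=> e1 e2 e3 e4 e5 e6 hpq; move: e3 e6.
    rewrite (xcomp_old _ (xold_e e1)) (xcomp_old _ (xold_e e2)).
    rewrite (xcomp_old _ (xold_e e4)) (xcomp_old _ (xold_e e5)) => e3 e6.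
    rewrite (xcomp_old _ (xold_e e3)) (xcomp_old _ (xold_e e6)).
    by congr xold; apply: (exchange (catP C)).
  subst k; have [a ->] := xtopP x; have [b ->] := xtopP y.
  have [c ->] := xtopP z; have [d ->] := xtopP w.
  move=> e1 e2 e3 e4 e5 e6 hpq; move: e3 e6.
  rewrite (xcomp_new _ (xnew_e e1)) (xcomp_new _ (xnew_e e2)).
  rewrite (xcomp_new _ (xnew_e e4)) (xcomp_new _ (xnew_e e5)) => e3 e6.
  rewrite (xcomp_new _ (xnew_e e3)) (xcomp_new _ (xnew_e e6)).
  by congr xnew; apply: scls_eq; apply: eqv_exchange.
- move=> k h p x y e; have [h1|h1] := ltnP k n.
    move: e; have [a ->] := xlowP x (ltnW h1); have [b ->] := xlowP y (ltnW h1).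
    move=> e; rewrite (xidc_old _ h1 a) (xidc_old _ h1 b) => e'.
    rewrite (xcomp_old _ (xold_e e)) (xcomp_old _ (xold_e e')).
    by rewrite (xidc_old _ h1); congr xold; apply: (idc_comp (catP C)).
  have ek : k = n by apply/eqP; rewrite eqn_leq h1 andbT; apply: h.
  subst k; move: e; have [a ->] := xlowP x (leqnn n).
  have [b ->] := xlowP y (leqnn n) => e; rewrite (xidc_new _ a) (xidc_new _ b) => e'.
  rewrite (xcomp_old _ (xold_e e)) xidc_new (xcomp_new _ (xnew_e e')).
  by congr xnew; apply: scls_eq; apply: eqv_idc_comp.
Qed.

Definition free_ext : ncat n.+1 := Cat ext_axioms.

Definition free_gen (a : S) : free_ext n.+1 := xnew (scls (pgen a)).

Lemma free_gen_par (a b : S) :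
  s a = s b -> t a = t b -> parallel (free_gen a) (free_gen b).
Proof. by move=> hs ht; split; rewrite ?xnew_src ?xnew_tgt /= ?hs ?ht. Qed.
End FreeExtension.

Section DiscreteCategory.
Variable S0 : Type.

Definition disc_cell (k : nat) : Type := if k is 0 then S0 else Empty_set.

Definition disc_bd k (x : disc_cell k.+1) : disc_cell k := match x with end.

Definition disc_glob : globular.
Proof. by apply: (@Globular disc_cell disc_bd disc_bd) => k []. Defined.

Definition disc_idc k (h : within (Some 0) k.+1) (x : disc_glob k) :
  disc_glob k.+1 := False_rect _ (notF h).

Definition disc_data : cat_data (Some 0) :=
  @CatData (Some 0) disc_glob (fun k p u v e => u) disc_idc.

Lemma disc_axioms : cat_axioms disc_data.
Proof.
split=> //; try by [move=> k []|move=> k p []|move=> [|k] [] //|move=> k p u v []].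
by case.
Qed.

Definition disc : ncat 0 := Cat disc_axioms.
End DiscreteCategory.

(* [tower C], for C an n-category: the generators of dimension n+1, n+2, ... of
   a polygraph whose generators of dimension at most n generate C. *)
CoInductive tower (n : nat) (C : ncat n) : Type := Tower {
  gens : Type;
  gsrc : gens -> C n;
  gtgt : gens -> C n;
  gpar : forall a, parallel (gsrc a) (gtgt a);
  next : tower (free_ext gpar) }.

Arguments gens {n C} t : rename.
Arguments gsrc {n C} t _ : rename.
Arguments gtgt {n C} t _ : rename.
Arguments gpar {n C} t _ : rename.
Arguments next {n C} t : rename.

Record polygraph := Polygraph {
  gens0 : Type;
  tower0 : tower (disc gens0) }.

Section FreeComplex.
Variable S : polygraph.

(* The n-category generated by the generators of dimension at most n, together
   with the remaining generators. *)
Fixpoint stage (n : nat) : {C : ncat n & tower C} :=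
  match n with
  | 0 => existT _ (disc (gens0 S)) (tower0 S)
  | n'.+1 =>
      existT _ (free_ext (gpar (projT2 (stage n')))) (next (projT2 (stage n')))
  end.

Definition trunc (n : nat) : ncat n := projT1 (stage n).

Definition star_cell (n : nat) : Type := trunc n n.

(* The cells of dimension at most n are the same in [trunc n] and
   [trunc n.+1]. *)
Definition back n k (x : trunc n.+1 k) (h : k <= n) : trunc n k := xo x h.
Definition fwd n k (x : trunc n k) : trunc n.+1 k := xold (gpar (projT2 (stage n))) x.

Lemma backK n k (x : trunc n.+1 k) h : fwd (back x h) = x.
Proof. exact: xoK. Qed.

Lemma fwd_inj n k (x y : trunc n k) : fwd x = fwd y -> x = y.
Proof. exact: xold_inj. Qed.

Definition star_src k (x : star_cell k.+1) : star_cell k :=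
  back (src (x : trunc k.+1 k.+1)) (leqnn k).
Definition star_tgt k (x : star_cell k.+1) : star_cell k :=
  back (tgt (x : trunc k.+1 k.+1)) (leqnn k).

Lemma fwd_src n k (x : trunc n k.+1) : fwd (src x) = src (fwd x).
Proof. by []. Qed.
Lemma fwd_tgt n k (x : trunc n k.+1) : fwd (tgt x) = tgt (fwd x).
Proof. by []. Qed.

Lemma star_ss k (x : star_cell k.+2) :
  star_src (star_src x) = star_src (star_tgt x).
Proof.
by do 2!apply: fwd_inj; rewrite /star_src /star_tgt !backK !fwd_src !backK src_src.
Qed.

Lemma star_ts k (x : star_cell k.+2) :
  star_tgt (star_src x) = star_tgt (star_tgt x).
Proof.
by do 2!apply: fwd_inj; rewrite /star_src /star_tgt !backK !fwd_tgt !backK tgt_src.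
Qed.

Definition star_glob : globular := Globular star_ss star_ts.

Fixpoint down k : forall p : idx k, trunc k (ival p) -> star_cell (ival p) :=
  match k return forall p : idx k, trunc k (ival p) -> star_cell (ival p) with
  | 0 => fun p => match p with end
  | k'.+1 => fun p =>
      match p return trunc k'.+1 (@ival k'.+1 p) -> star_cell (@ival k'.+1 p) with
      | None => fun x => back x (leqnn k')
      | Some q => fun x => @down k' q (back x (ltnW (ival_lt q)))
      end
  end.

Lemma back_inj n k (x y : trunc n.+1 k) h : back x h = back y h -> x = y.
Proof. by move=> e; rewrite -(backK x h) e backK. Qed.

Lemma down_inj k (p : idx k) x y : @down k p x = @down k p y -> x = y.
Proof.
elim: k p x y => [[]|k IH [q|]] x y /=; last exact: back_inj.
by move=> /IH /back_inj.
Qed.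

Lemma fwd_isrc n k (p : idx k) (x : trunc n k) :
  isrc p (fwd x) = fwd (isrc p x).
Proof. exact: xisrc_old. Qed.
Lemma fwd_itgt n k (p : idx k) (x : trunc n k) :
  itgt p (fwd x) = fwd (itgt p x).
Proof. exact: xitgt_old. Qed.

Lemma star_isrc k (p : idx k) (x : star_cell k) :
  @isrc star_glob k p x = down (isrc p (x : trunc k k)).
Proof.
elim: k p x => [[]|k IH [q|]] x //.
transitivity (@isrc star_glob k q (star_src x)) => //.
rewrite IH /=; congr down; apply: fwd_inj.
by rewrite -fwd_isrc /star_src !backK.
Qed.

Lemma star_itgt k (p : idx k) (x : star_cell k) :
  @itgt star_glob k p x = down (itgt p (x : trunc k k)).
Proof.
elim: k p x => [[]|k IH [q|]] x //.
transitivity (@itgt star_glob k q (star_tgt x)) => //.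
rewrite IH /=; congr down; apply: fwd_inj.
by rewrite -fwd_itgt /star_tgt !backK.
Qed.

Lemma star_e k (p : idx k) (u v : star_cell k) :
  @itgt star_glob k p u = @isrc star_glob k p v ->
  itgt p (u : trunc k k) = isrc p (v : trunc k k).
Proof. by rewrite star_itgt star_isrc => /down_inj. Qed.

Definition star_comp k (p : idx k) (u v : star_glob k)
    (e : itgt p u = isrc p v) : star_glob k :=
  @comp _ (trunc k) k p u v (star_e e).

Definition star_idc k (h : within None k.+1) (x : star_glob k) : star_glob k.+1 :=
  @idc _ (trunc k.+1) k (leqnn k.+1) (fwd x).

Definition star_data : cat_data None := CatData star_comp star_idc.

Lemma star_iidc k (p : idx k) h h' x :
  @iidc _ star_data k p h (down x) = @iidc _ (trunc k) k p h' x.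
Proof.
elim: k p h h' x => [[]|k IH [q|]] h h' x.
  rewrite /= (IH _ _ (leqnn k)) /star_idc; apply: idc_eq.
  rewrite -[in RHS](backK x (ltnW (ival_lt q))).
  by symmetry; apply: xiidc_old.
by rewrite /= /star_idc; apply: idc_eq; apply: backK.
Qed.

Lemma back_eq n k (x : trunc n.+1 k) (y : trunc n k) h :
  x = fwd y -> back x h = y.
Proof. by move=> ->. Qed.

Lemma comp_fwd n k (p : idx k) (a b : trunc n k) e e' :
  comp p (fwd a) (fwd b) e = fwd (comp p a b e').
Proof. exact: xcomp_old. Qed.

Lemma star_axioms : cat_axioms star_data.
Proof.
split=> //.
- by move=> k h x; apply: back_eq; apply: (src_idc (catP (trunc k.+1))).
- by move=> k h x; apply: back_eq; apply: (tgt_idc (catP (trunc k.+1))).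
- by move=> k u v e; congr back; apply: (src_comp_top (catP (trunc k.+1))).
- by move=> k u v e; congr back; apply: (tgt_comp_top (catP (trunc k.+1))).
- move=> k p u v e e'; apply: back_eq; have e1 := star_e e'.
  pose a : trunc k.+1 k := src (u : trunc k.+1 k.+1).
  pose b : trunc k.+1 k := src (v : trunc k.+1 k.+1).
  have e2 : itgt p (fwd (back a (leqnn k))) = isrc p (fwd (back b (leqnn k))).
    by rewrite fwd_itgt fwd_isrc; congr fwd.
  have e3 : itgt p a = isrc p b by rewrite -(backK a (leqnn k)) e2 backK.
  apply: etrans (src_comp_up (catP (trunc k.+1)) _ e3) _.
  transitivity (comp p (fwd (back a (leqnn k))) (fwd (back b (leqnn k))) e2).
    by apply: comp_eq; rewrite backK.
  exact: comp_fwd.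
- move=> k p u v e e'; apply: back_eq; have e1 := star_e e'.
  pose a : trunc k.+1 k := tgt (u : trunc k.+1 k.+1).
  pose b : trunc k.+1 k := tgt (v : trunc k.+1 k.+1).
  have e2 : itgt p (fwd (back a (leqnn k))) = isrc p (fwd (back b (leqnn k))).
    by rewrite fwd_itgt fwd_isrc; congr fwd.
  have e3 : itgt p a = isrc p b by rewrite -(backK a (leqnn k)) e2 backK.
  apply: etrans (tgt_comp_up (catP (trunc k.+1)) _ e3) _.
  transitivity (comp p (fwd (back a (leqnn k))) (fwd (back b (leqnn k))) e2).
    by apply: comp_eq; rewrite backK.
  exact: comp_fwd.
- by move=> k p u v w e1 e2 e3 e4; apply: (compA (catP (trunc k))).
- move=> k p h u.
  have -> : @iidc _ star_data k p h (@isrc star_glob k p u) =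
            @iidc _ (trunc k) k p (leqnn k) (isrc p (u : trunc k k)).
    by rewrite star_isrc; apply: star_iidc.
  by move=> e; apply: (comp_idl (catP (trunc k))).
- move=> k p h u.
  have -> : @iidc _ star_data k p h (@itgt star_glob k p u) =
            @iidc _ (trunc k) k p (leqnn k) (itgt p (u : trunc k k)).
    by rewrite star_itgt; apply: star_iidc.
  by move=> e; apply: (comp_idr (catP (trunc k))).
- by move=> k p q x y z t e1 e2 e3 e4 e5 e6; apply: (exchange (catP (trunc k))).
- move=> k h p x y e e'.
  have e1 : itgt p (fwd (x : trunc k k)) = isrc p (fwd (y : trunc k k)).
    by rewrite fwd_itgt fwd_isrc (star_e e).
  transitivity (@idc _ (trunc k.+1) k (leqnn k.+1)
                  (comp p (fwd (x : trunc k k)) (fwd (y : trunc k k)) e1)).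
    apply: (@idc_eq _ (trunc k.+1) k _ _ (fwd (star_comp e))).
    by symmetry; apply: (@comp_fwd k k p x y e1 (star_e e)).
  exact: (idc_comp (catP (trunc k.+1))).
Qed.

Definition star : complex := Cat star_axioms.
End FreeComplex.

(* A globular set seen as a polygraph: the boundaries of its generators are
   generators.  Its free complex is the one freely generated by the globular
   set. *)
Section FreeOnGlobular.
Variable X : globular.

CoFixpoint glob_tower (n : nat) (C : ncat n) (eta : X n -> C n)
    (eta_par : forall x y, parallel x y -> parallel (eta x) (eta y)) : tower C :=
  @Tower n C (X n.+1) (fun a => eta (src a)) (fun a => eta (tgt a))
    (fun a => eta_par _ _ (par_src_tgt a))
    (@glob_tower n.+1 _ (fun a => free_gen _ a)
      (fun a b hab => free_gen_par _ (f_equal eta (proj1 hab))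
                                     (f_equal eta (proj2 hab)))).

Definition glob_polygraph : polygraph :=
  @Polygraph (X 0) (@glob_tower 0 (disc (X 0)) (fun x => x) (fun _ _ h => h)).

Definition free_on : complex := star glob_polygraph.
End FreeOnGlobular.

Record subcomplex (C : complex) := Subcomplex {
  sub_in :> forall k, C k -> Prop;
  sub_src : forall k (x : C k.+1), sub_in x -> sub_in (src x);
  sub_tgt : forall k (x : C k.+1), sub_in x -> sub_in (tgt x);
  sub_idc : forall k h (x : C k), sub_in x -> sub_in (idc h x);
  sub_comp : forall k (p : idx k) (x y : C k) e,
    sub_in x -> sub_in y -> sub_in (comp p x y e) }.

Section Subcomplex.
Variables (C : complex) (P : subcomplex C).

Definition sub_cell (k : nat) : Type := {x : C k | P k x}.

Definition sub_glob : globular.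
Proof.
apply: (@Globular sub_cell
  (fun k x => exist (P k) (src (sval x)) (sub_src (svalP x)))
  (fun k x => exist (P k) (tgt (sval x)) (sub_tgt (svalP x)))) => k x.
- by apply: sig_eq; apply: src_src.
- by apply: sig_eq; apply: tgt_src.
Defined.

Lemma sub_isrc k (p : idx k) (x : sub_glob k) :
  sval (isrc p x) = isrc p (sval x).
Proof. by elim: k p x => [[]|k IH [q|]] x //=; rewrite IH. Qed.

Lemma sub_itgt k (p : idx k) (x : sub_glob k) :
  sval (itgt p x) = itgt p (sval x).
Proof. by elim: k p x => [[]|k IH [q|]] x //=; rewrite IH. Qed.

Lemma sub_e k (p : idx k) (u v : sub_glob k) :
  itgt p u = isrc p v -> itgt p (sval u) = isrc p (sval v).
Proof. by move=> e; rewrite -sub_itgt e sub_isrc. Qed.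

Definition sub_data : cat_data None :=
  @CatData None sub_glob
    (fun k p u v e => exist (P k) (comp p (sval u) (sval v) (sub_e e))
                        (sub_comp (sub_e e) (svalP u) (svalP v)))
    (fun k h x => exist (P k.+1) (@idc _ C k h (sval x)) (sub_idc h (svalP x))).

Lemma sub_iidc k (p : idx k) h (x : sub_glob (ival p)) :
  sval (@iidc _ sub_data k p h x) = @iidc _ C k p h (sval x).
Proof. by elim: k p h x => [[]|k IH [q|]] h x //=; rewrite IH. Qed.

Lemma sub_axioms : cat_axioms sub_data.
Proof.
have CP := catP C; split=> //.
- by move=> k h x; apply: sig_eq; apply: (src_idc CP).
- by move=> k h x; apply: sig_eq; apply: (tgt_idc CP).
- by move=> k u v e; apply: sig_eq; apply: (src_comp_top CP).
- by move=> k u v e; apply: sig_eq; apply: (tgt_comp_top CP).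
- by move=> k p u v e e'; apply: sig_eq; apply: (src_comp_up CP).
- by move=> k p u v e e'; apply: sig_eq; apply: (tgt_comp_up CP).
- by move=> k p u v w e1 e2 e3 e4; apply: sig_eq; apply: (compA CP).
- move=> k p h u e; apply: sig_eq => /=; move: (sub_e e).
  by rewrite sub_iidc sub_isrc => e'; apply: (comp_idl CP).
- move=> k p h u e; apply: sig_eq => /=; move: (sub_e e).
  by rewrite sub_iidc sub_itgt => e'; apply: (comp_idr CP).
- by move=> k p q x y z t e1 e2 e3 e4 e5 e6 h; apply: sig_eq; apply: (exchange CP).
- by move=> k h p x y e e'; apply: sig_eq; apply: (idc_comp CP).
Qed.

Definition sub_complex : complex := Cat sub_axioms.

Definition sub_incl : mor sub_complex C.
Proof.
apply: (@Mor sub_complex C (fun k x => sval x)) => // k p u v e e'.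
exact: comp_eq.
Defined.
End Subcomplex.

Section Generated.
Variables (C : complex) (A : forall k, C k -> Prop).

Inductive generated : forall k, C k -> Prop :=
| gen_base k (x : C k) : A x -> generated x
| gen_src k (x : C k.+1) : generated x -> generated (src x)
| gen_tgt k (x : C k.+1) : generated x -> generated (tgt x)
| gen_idc k h (x : C k) : generated x -> generated (idc h x)
| gen_comp k (p : idx k) (x y : C k) e :
    generated x -> generated y -> generated (comp p x y e).

Definition gen_subcomplex : subcomplex C :=
  Subcomplex gen_src gen_tgt gen_idc gen_comp.
End Generated.

(* The cells of the globular set represented by n; in each dimension below n,
   [false] is the source cell and [true] the target cell. *)
Inductive globe_cell (n : nat) : nat -> Type :=
| globe_top : globe_cell n n
| globe_bd k (b : bool) : k < n -> globe_cell n k.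

Lemma globe_lt n k (x : globe_cell n k.+1) : k < n.
Proof.
suff H m (y : globe_cell n m) : m <= n by exact: H x.
by case: y => // j _ /ltnW.
Qed.

Definition globe (n : nat) : globular :=
  @Globular (globe_cell n)
    (fun k x => globe_bd false (globe_lt x))
    (fun k x => globe_bd true (globe_lt x))
    (fun k x => f_equal (globe_bd false) (bool_irrelevance _ _))
    (fun k x => f_equal (globe_bd true) (bool_irrelevance _ _)).

Definition O_ (n : nat) : complex := free_on (globe n).

Definition O_below (n : nat) : subcomplex (O_ n) :=
  gen_subcomplex (fun k _ => k < n).

Definition dO (n : nat) : complex := sub_complex (O_below n).

Definition i_ (n : nat) : mor (dO n) (O_ n) := sub_incl (O_below n).

Definition left_orthogonal (A B C D : complex) (f : mor A B) (g : mor C D) :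
    Prop :=
  forall (u : mor A C) (v : mor B D), mcomp g u = mcomp v f ->
  exists h : mor B C, mcomp h f = u /\ mcomp g h = v.

Definition trivial_fibration (C D : complex) (g : mor C D) : Prop :=
  forall n, left_orthogonal (i_ n) g.

Definition cofibration (A B : complex) (f : mor A B) : Prop :=
  forall (C D : complex) (g : mor C D),
  trivial_fibration g -> left_orthogonal f g.

Definition empty_cell (k : nat) : Type := Empty_set.

Definition empty_glob : globular.
Proof.
by apply: (@Globular empty_cell (fun _ x => x) (fun _ x => x)) => k [].
Defined.

Definition empty_data : cat_data None :=
  @CatData None empty_glob (fun k p u v e => u) (fun k h x => x).

Lemma empty_axioms : cat_axioms empty_data.
Proof.
split=> //; try by [move=> k h []|move=> k []|move=> k p []|move=> k p h []].
Qed.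

Definition empty_complex : complex := Cat empty_axioms.

Definition from_empty (C : complex) : mor empty_complex C.
Proof.
by apply: (@Mor empty_complex C (fun k x => match x with end)) => k;
  [case|case|move=> h []|move=> p []].
Defined.

Definition cofibrant (C : complex) : Prop := cofibration (from_empty C).

(* Main.v *)
From mathcomp Require Import all_boot boolp.
Require Import Defs.

(** Why free complexes are cofibrant.

    A trivial fibration [g : C -> D] lifts cells: every 0-cell of [D] has a
    preimage, and for parallel n-cells [x], [y] of [C], every (n+1)-cell of [D]
    from [g x] to [g y] is the image of a cell from [x] to [y] ([fib_lift0],
    [fib_liftS]).  Given [v : star S -> D], a lift [h : star S -> C] of [v] is
    then built by induction on the dimension ([lift_star]).  Once [h] is known
    up to dimension n, the boundary of a generator [a] of dimension n+1 is sent
    to two parallel cells of [C] lying over the boundary of [v a], so an image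
    of [a] over [v a] can be chosen; as cells of dimension n+1 are freely
    generated, these choices extend to all of them ([ext_functor]), and [g h]
    agrees with [v] there because the two agree on generators
    ([star_succ_ind]).  The lifts up to dimension n+1 restrict to those up to
    dimension n and glue together ([chain_upto]).

    The cell-lifting property is orthogonality to the inclusions of the
    boundaries of globes, once morphisms out of globes and of their boundaries
    are known.  A globular map out of [X] extends to the complex free on [X]
    ([free_on_extend]) in only one way ([free_on_agree]), so an n-cell gives a
    morphism from the n-globe ([globe_map]).  The boundary of the (m+1)-globe is
    defined as a generated subcomplex, not as a free complex.  It contains all
    cells of the globe up to dimension m, and only identities above
    ([dO_idc]).  Hence a morphism out of it can be built from its restriction to
    dimensions at most m ([degen_mor]), and that restriction comes from the
    freeness of the globe, truncated at dimension m ([globe_pair_map]).  This is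
    why morphisms defined up to some dimension ([mor_upto]) are used
    throughout. *)

Set Implicit Arguments.
Unset Strict Implicit.
Unset Printing Implicit Defensive.

(** * Functors to a complex *)

Record functor N (A : cat N) (B : complex) := Functor {
  functor_fun :> forall k, A k -> B k;
  functor_src : forall k (x : A k.+1), functor_fun (src x) = src (functor_fun x);
  functor_tgt : forall k (x : A k.+1), functor_fun (tgt x) = tgt (functor_fun x);
  functor_idc : forall k h h' (x : A k), functor_fun (idc h x) = idc h' (functor_fun x);
  functor_comp : forall k (p : idx k) (u v : A k) e e',
    functor_fun (comp p u v e) = comp p (functor_fun u) (functor_fun v) e' }.

Arguments functor_comp {N A B} f {k p u v} e e' : rename.

Section FunctorTheory.
Variables (N : option nat) (A : cat N) (B : complex) (f : functor A B).

Lemma functor_isrc k (p : idx k) (x : A k) : f _ (isrc p x) = isrc p (f _ x).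
Proof. by elim: k p x => [[]|k IH [q|]] x /=; rewrite ?IH functor_src. Qed.

Lemma functor_itgt k (p : idx k) (x : A k) : f _ (itgt p x) = itgt p (f _ x).
Proof. by elim: k p x => [[]|k IH [q|]] x /=; rewrite ?IH functor_tgt. Qed.

Lemma functor_iidc k (p : idx k) h h' (x : A (ival p)) :
  f _ (iidc p h x) = iidc p h' (f _ x).
Proof.
elim: k p h h' x => [[]|k IH [q|]] h h' x /=; last exact: functor_idc.
by rewrite (functor_idc f _ h'); apply: idc_eq; apply: IH.
Qed.

Lemma functor_par k (x y : A k) : parallel x y -> parallel (f _ x) (f _ y).
Proof.
by case: k x y => [|k] x y //= [h1 h2]; rewrite -!functor_src -!functor_tgt h1 h2.
Qed.

Lemma functor_e k (p : idx k) (x y : A k) :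
  itgt p x = isrc p y -> itgt p (f _ x) = isrc p (f _ y).
Proof. by move=> e; rewrite -functor_itgt e functor_isrc. Qed.
End FunctorTheory.

Lemma mor_e (A B : complex) (f : mor A B) k (p : idx k) (x y : A k) :
  itgt p x = isrc p y -> itgt p (f _ x) = isrc p (f _ y).
Proof. by move=> e; rewrite -mor_itgt e mor_isrc. Qed.

(** * Induction and recursion on a free extension *)

Section FreeExtension.
Variables (n : nat) (A : ncat n) (S : Type) (s t : S -> A n).
Hypothesis st_par : forall a, parallel (s a) (t a).

(** Formal composites are made of generators and identities by composition, and
    every new cell is the class of such a composite. *)
Lemma free_ext_ind (P : free_ext st_par n.+1 -> Prop) :
  (forall a, P (free_gen st_par a)) ->
  (forall h (c : A n), P (@idc _ (free_ext st_par) n h (xold st_par c))) ->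
  (forall p u v e, P u -> P v -> P (@comp _ (free_ext st_par) n.+1 p u v e)) ->
  forall x, P x.
Proof.
move=> Pgen Pidc Pcomp x; have [[a b w] ->] := xtopP x.
have Pc p c d e : P (xnew (cls (eqv st_par) c)) -> P (xnew (cls (eqv st_par) d)) ->
    P (xnew (cls (eqv st_par) (@pcomp _ _ _ _ _ st_par p c d e))).
  move=> Pa Pb.
  have e' : @itgt (xglob st_par) n.+1 p (xnew (cls (eqv st_par) c)) =
            @isrc (xglob st_par) n.+1 p (xnew (cls (eqv st_par) d)).
    rewrite xitgt_new xisrc_new (pitgt_eqv _ (rep_scls st_par c)).
    by rewrite (pisrc_eqv _ (rep_scls st_par d)) e.
  by rewrite -(xcomp_new e'); apply: Pcomp.
elim: w => {x a b} [a|c|x y y' z e l IHl r IHr|p x y x' y' es et l IHl r IHr].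
- exact: Pgen.
- by move: (Pidc (ltnSn n) c); rewrite xidc_new.
- exact: (Pc (itop n) (Pcell l) (Pcell r) e).
- have e : itgt p y = isrc p x'.
    by rewrite -(itgt_par p (expr_par st_par l)).
  have := Pc (iup p) (Pcell l) (Pcell r) e IHl IHr.
  (* The composability proofs carried by the formal composite are arbitrary. *)
  rewrite /=; move: (up_es _ _) (up_et _ _) => es' et'.
  by rewrite (Prop_irrelevance es' es) (Prop_irrelevance et' et).
Qed.

Variables (B : complex) (f : functor A B) (phi : S -> B n.+1).
Hypothesis src_phi : forall a, src (phi a) = f _ (s a).
Hypothesis tgt_phi : forall a, tgt (phi a) = f _ (t a).

Definition bounded (x y : A n) (c : B n.+1) := src c = f _ x /\ tgt c = f _ y.

Lemma bounded_idc c : bounded c c (@idc _ B n isT (f _ c)).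
Proof. by split; [apply: (src_idc (catP B))|apply: (tgt_idc (catP B))]. Qed.

Lemma top_e x y y' z c d (e : y = y') :
  bounded x y c -> bounded y' z d -> itgt (itop n) c = isrc (itop n) d.
Proof. by move=> [_ /= ->] [-> _]; rewrite e. Qed.

Lemma bounded_top x y y' z c d e :
  bounded x y c -> bounded y' z d -> bounded x z (comp (itop n) c d e).
Proof.
move=> [h _] [_ h']; split.
  by rewrite (src_comp_top (catP B)).
by rewrite (tgt_comp_top (catP B)).
Qed.

Lemma iup_e (p : idx n) x y x' y' c d (es : itgt p x = isrc p x') :
  bounded x y c -> bounded x' y' d -> itgt (iup p) c = isrc (iup p) d.
Proof.
move=> [h _] [h' _] /=.
by rewrite -(itgt_par p (par_src_tgt c)) h h'; apply: functor_e.
Qed.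

Lemma bounded_up (p : idx n) x y x' y' c d es et e :
  bounded x y c -> bounded x' y' d ->
  bounded (comp p x x' es) (comp p y y' et) (comp (iup p) c d e).
Proof.
move=> [h1 h2] [h1' h2']; split.
  have e1 : itgt p (src c) = isrc p (src d) by rewrite h1 h1'; apply: functor_e.
  rewrite (src_comp_up (catP B) e e1) (functor_comp f es (functor_e f es)).
  exact: comp_eq.
have e2 : itgt p (tgt c) = isrc p (tgt d) by rewrite h2 h2'; apply: functor_e.
rewrite (tgt_comp_up (catP B) e e2) (functor_comp f et (functor_e f et)).
exact: comp_eq.
Qed.

(** The value of a formal composite.  Its boundary is computed at the same time,
    as composites of values are defined only when the boundaries match. *)
Fixpoint eval x y (w : expr s t x y) : {c : B n.+1 | bounded x y c} :=
  match w in expr _ _ x y return {c : B n.+1 | bounded x y c} with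
  | egen a => exist _ (phi a) (conj (src_phi a) (tgt_phi a))
  | eidc c => exist _ (@idc _ B n isT (f _ c)) (bounded_idc c)
  | ecomp_top _ _ _ _ e l r =>
      let: exist c hc := eval l in let: exist d hd := eval r in
      exist _ (comp (itop n) c d (top_e e hc hd)) (bounded_top (top_e e hc hd) hc hd)
  | ecomp_up p _ _ _ _ es et l r =>
      let: exist c hc := eval l in let: exist d hd := eval r in
      exist _ (comp (iup p) c d (iup_e es hc hd)) (bounded_up es et (iup_e es hc hd) hc hd)
  end.

Definition peval (a : pcell s t) : B n.+1 := sval (eval (pexpr a)).

Lemma peval_src a : src (peval a) = f _ (psrc a).
Proof. by rewrite /peval; case: eval => c []. Qed.

Lemma peval_tgt a : tgt (peval a) = f _ (ptgt a).
Proof. by rewrite /peval; case: eval => c []. Qed.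

Lemma peval_isrc p a : isrc p (peval a) = f _ (pisrc p a).
Proof. by case: p => [q|] /=; rewrite peval_src ?functor_isrc. Qed.

Lemma peval_itgt p a : itgt p (peval a) = f _ (pitgt p a).
Proof. by case: p => [q|] /=; rewrite peval_tgt ?functor_itgt. Qed.

Lemma peval_e p a b :
  pitgt p a = pisrc p b -> itgt p (peval a) = isrc p (peval b).
Proof. by rewrite peval_itgt peval_isrc => ->. Qed.

Lemma peval_comp p a b e e' :
  peval (@pcomp _ _ _ _ _ st_par p a b e) = comp p (peval a) (peval b) e'.
Proof.
by case: p e e' => [q|] e; rewrite /peval /=;
   case: eval => c hc; case: eval => d hd e' /=; apply: comp_eq.
Qed.

Lemma peval_iidc (p : idx n.+1) h (x : A (ival p)) :
  peval (@piidc _ _ _ s t p x) = iidc p h (f _ x).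
Proof.
case: p h x => [q|] h x; last exact: idc_eq.
by apply: idc_eq; apply: functor_iidc.
Qed.

(** The relations imposed on formal composites are the axioms of complexes, and
    these hold among the values. *)
Lemma peval_eqv a b : eqv st_par a b -> peval a = peval b.
Proof.
elim=> {a b} [//|a b _ -> //|a b c _ -> _ -> //|p a a' b b' e e' _ h1 _ h2|
  p a b c e1 e2 e3 e4|p a e|p a e|p q a b c d e1 e2 e3 e4 e5 e6 hpq|p x y e e'].
- by rewrite (peval_comp _ (peval_e e)) (peval_comp _ (peval_e e')); apply: comp_eq.
- have E1 := peval_comp _ (peval_e e1); have E3 := peval_comp _ (peval_e e3).
  have := peval_e e2; rewrite (peval_comp _ (peval_e e2)).
  have := peval_e e4; rewrite (peval_comp _ (peval_e e4)).
  move: (peval_e e2) (peval_e e4); rewrite E1 E3 => E2 E4 _ _.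
  exact: (compA (catP B)).
- rewrite (peval_comp _ (peval_e e)); move: (peval_e e).
  rewrite (@peval_iidc p isT) => e'; apply: comp_idl'.
  by rewrite peval_isrc.
- rewrite (peval_comp _ (peval_e e)); move: (peval_e e).
  rewrite (@peval_iidc p isT) => e'; apply: comp_idr'.
  by rewrite peval_itgt.
- rewrite (peval_comp _ (peval_e e3)) (peval_comp _ (peval_e e6)).
  move: (peval_e e3) (peval_e e6).
  rewrite (peval_comp _ (peval_e e1)) (peval_comp _ (peval_e e2)).
  rewrite (peval_comp _ (peval_e e4)) (peval_comp _ (peval_e e5)) => E3 E6.
  exact: (exchange (catP B)).
- rewrite (peval_comp _ (peval_e e')).
  transitivity (@idc _ B n isT (comp p (f _ x) (f _ y) (functor_e f e))).
    by apply: idc_eq; apply: functor_comp.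
  exact: (idc_comp (catP B)).
Qed.

Definition ext_fun k (x : free_ext st_par k) : B k :=
  match x in xcell _ k return B k with
  | xold k c => f k c
  | xnew c => peval (repr c)
  end.

Lemma ext_fun_new a : ext_fun (xnew (cls (eqv st_par) a)) = peval a.
Proof. by apply: peval_eqv; apply: rep_scls. Qed.

Lemma ext_fun_idc k h h' (x : free_ext st_par k) :
  ext_fun (idc h x) = idc h' (ext_fun x).
Proof.
have [h1|h1] := ltnP k n.
  have [c ->] := xlowP x (ltnW h1).
  by rewrite (xidc_old _ _ h1) /=; apply: functor_idc.
have e : k = n by apply/eqP; rewrite eqn_leq h1 andbT; apply: h.
subst k; have [c ->] := xlowP x (leqnn n).
by rewrite xidc_new ext_fun_new; apply: idc_eq.
Qed.

Lemma ext_fun_comp k (p : idx k) (u v : free_ext st_par k) e e' :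
  ext_fun (comp p u v e) = comp p (ext_fun u) (ext_fun v) e'.
Proof.
case: (xdimP u) => [h|ek].
  move: e e'; have [a ->] := xlowP u h; have [b ->] := xlowP v h => e e'.
  by rewrite (xcomp_old _ (xold_e e)); apply: functor_comp.
subst k; move: e e'; have [a ->] := xtopP u; have [b ->] := xtopP v => e.
rewrite (xcomp_new _ (xnew_e e)) !ext_fun_new => e'; exact: peval_comp.
Qed.

Lemma ext_fun_src k (x : free_ext st_par k.+1) :
  ext_fun (src x) = src (ext_fun x).
Proof.
case: (xdimP x) => [h|[e]].
  by have [c ->] := xlowP x h; apply: functor_src.
subst k; have [a ->] := xtopP x.
by rewrite xnew_src ext_fun_new peval_src.
Qed.

Lemma ext_fun_tgt k (x : free_ext st_par k.+1) :
  ext_fun (tgt x) = tgt (ext_fun x).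
Proof.
case: (xdimP x) => [h|[e]].
  by have [c ->] := xlowP x h; apply: functor_tgt.
subst k; have [a ->] := xtopP x.
by rewrite xnew_tgt ext_fun_new peval_tgt.
Qed.

Definition ext_functor : functor (free_ext st_par) B :=
  Functor ext_fun_src ext_fun_tgt ext_fun_idc ext_fun_comp.

Lemma ext_functor_gen a : ext_functor _ (free_gen st_par a) = phi a.
Proof. exact: ext_fun_new. Qed.
End FreeExtension.

Section DiscreteFunctor.
Variables (S0 : Type) (B : complex) (phi : S0 -> B 0).

Definition disc_fun k : disc S0 k -> B k :=
  if k is 0 then phi else fun x => match x with end.

Definition disc_functor : functor (disc S0) B.
Proof.
apply: (@Functor _ _ _ disc_fun) => [k []|k []|//|k p].
by case: k p => [[]|k p []].
Defined.
End DiscreteFunctor.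

(** * Morphisms up to a given dimension *)

(** A dimension bound [N], possibly infinite, allows the freeness of globes and
    that of their boundaries to be treated together. *)
Record mor_upto N (A B : complex) := MorUpto {
  ufun :> forall k, within N k -> A k -> B k;
  upto_src : forall k w w' (x : A k.+1), ufun w' (src x) = src (ufun w x);
  upto_tgt : forall k w w' (x : A k.+1), ufun w' (tgt x) = tgt (ufun w x);
  upto_idc : forall k w w' h (x : A k), ufun w (idc h x) = idc h (ufun w' x);
  upto_comp : forall k w (p : idx k) (u v : A k) e e',
    ufun w (comp p u v e) = comp p (ufun w u) (ufun w v) e' }.

Arguments upto_comp {N A B} f {k} w {p u v} e e' : rename.

Definition mor_of_upto A B (f : mor_upto None A B) : mor A B.
Proof.
apply: (@Mor A B (fun k => f k isT)) => *.
- exact: upto_src.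
- exact: upto_tgt.
- exact: upto_idc.
- exact: upto_comp.
Defined.

Lemma within_ival N k (p : idx k) : within N k -> within N (ival p).
Proof. by case: N => //= n; apply: leq_trans; apply: ltnW; apply: ival_lt. Qed.

Section UptoTheory.
Variables (N : option nat) (A B : complex) (f : mor_upto N A B).

Lemma upto_isrc k (p : idx k) w w' (x : A k) :
  f (ival p) w' (isrc p x) = isrc p (f k w x).
Proof.
elim: k p w w' x => [[]|k IH [q|]] w w' x /=; last exact: upto_src.
by rewrite (IH _ (within_pred w)) (upto_src f w).
Qed.

Lemma upto_itgt k (p : idx k) w w' (x : A k) :
  f (ival p) w' (itgt p x) = itgt p (f k w x).
Proof.
elim: k p w w' x => [[]|k IH [q|]] w w' x /=; last exact: upto_tgt.
by rewrite (IH _ (within_pred w)) (upto_tgt f w).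
Qed.

Lemma upto_e k w (p : idx k) (x y : A k) :
  itgt p x = isrc p y -> itgt p (f _ w x) = isrc p (f _ w y).
Proof. by move=> e; rewrite -(upto_itgt w (within_ival p w)) e; apply: upto_isrc. Qed.
End UptoTheory.

Definition upto_of_mor N A B (f : mor A B) : mor_upto N A B.
Proof.
apply: (@MorUpto N A B (fun k _ => f k)) => *.
- exact: mor_src.
- exact: mor_tgt.
- exact: mor_idc.
- exact: mor_comp.
Defined.

Definition upto_post N (A B C : complex) (g : mor B C) (f : mor_upto N A B) :
  mor_upto N A C.
Proof.
apply: (@MorUpto N A C (fun k w x => g k (f k w x))) =>
  [k w w' x|k w w' x|k w w' h x|k w p u v e e'].
- by rewrite (upto_src f w) mor_src.
- by rewrite (upto_tgt f w) mor_tgt.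
- by rewrite (upto_idc f w w') mor_idc.
- have e1 := upto_e f w e.
  by rewrite (upto_comp f w e e1) (mor_comp g e1 e').
Defined.

Definition upto_pre N (A B C : complex) (f : mor_upto N B C) (g : mor A B) :
  mor_upto N A C.
Proof.
apply: (@MorUpto N A C (fun k w x => f k w (g k x))) =>
  [k w w' x|k w w' x|k w w' h x|k w p u v e e'].
- by rewrite mor_src (upto_src f w).
- by rewrite mor_tgt (upto_tgt f w).
- by rewrite mor_idc (upto_idc f w w').
- have e1 := mor_e g e.
  by rewrite (mor_comp g e e1) (upto_comp f w e1 e').
Defined.

(** * Morphisms out of the free complex of a polygraph *)

Section Star.
Variable S : polygraph.

Definition star_gen k (a : gens (projT2 (stage S k))) : star S k.+1 :=
  free_gen (gpar (projT2 (stage S k))) a.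

Lemma star_gen_src k (a : gens (projT2 (stage S k))) :
  src (star_gen a) = gsrc (projT2 (stage S k)) a.
Proof. by apply: back_eq; apply: xnew_src. Qed.

Lemma star_gen_tgt k (a : gens (projT2 (stage S k))) :
  tgt (star_gen a) = gtgt (projT2 (stage S k)) a.
Proof. by apply: back_eq; apply: xnew_tgt. Qed.

(** [free_ext_ind] for the last extension, rephrased with the operations of the
    complex [star S]. *)
Lemma star_succ_ind k (P : star S k.+1 -> Prop) :
  (forall a, P (star_gen a)) ->
  (forall c : star S k, P (@idc _ (star S) k isT c)) ->
  (forall p u v e, P u -> P v -> P (comp p u v e)) ->
  forall x, P x.
Proof.
move=> Pgen Pidc Pcomp; apply: free_ext_ind => //.
- by move=> h c; rewrite (bool_irrelevance h (leqnn k.+1)); apply: (Pidc c).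
- move=> p u v e Pu Pv.
  have e' : @itgt (star S) _ p u = @isrc (star S) _ p v.
    by rewrite star_itgt star_isrc; congr down.
  by move: (Pcomp p u v e' Pu Pv); rewrite [e](Prop_irrelevance _ (star_e e')).
Qed.

(** Extending functors one dimension at a time.  The invariant [Inv] records what
    the functors built so far must satisfy for the next extension to exist. *)
Section Chain.
Variables (N : option nat) (B : complex).
Variable Inv : forall k, functor (trunc S k) B -> Prop.
Hypothesis start : exists f : functor (trunc S 0) B, Inv f.
Hypothesis step : forall k, within N k.+1 ->
  forall f : functor (trunc S k) B, Inv f ->
  exists f' : functor (trunc S k.+1) B,
    Inv f' /\ forall j (x : trunc S k j), f' j (fwd x) = f j x.

Fixpoint chain k : within N k -> {f : functor (trunc S k) B | Inv f} :=
  match k return within N k -> {f : functor (trunc S k) B | Inv f} with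
  | 0 => fun _ => cid start
  | k'.+1 => fun w =>
      let: exist f hf := chain (within_pred w) in
      let: exist f' hf' := cid (step w hf) in exist _ f' (proj1 hf')
  end.

Lemma chain_fwd k w w' j (x : trunc S k j) :
  sval (chain (k := k.+1) w) j (fwd x) = sval (chain w') j x.
Proof.
rewrite /= (Prop_irrelevance (within_pred w) w').
by case: chain => f hf; case: cid => f' [].
Qed.

(** By [chain_fwd] every later functor of the chain takes the same value on [x];
    the first one defined on [x] is chosen. *)
Definition chain_fun k (w : within N k) (x : star S k) : B k := sval (chain w) k x.

Definition chain_upto : mor_upto N (star S) B.
Proof.
apply: (@MorUpto _ _ _ chain_fun) => [k w w' x|k w w' x|k w w' h x|k w p u v e e'].
- by rewrite /chain_fun -(chain_fwd w) backK functor_src.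
- by rewrite /chain_fun -(chain_fwd w) backK functor_tgt.
- rewrite /chain_fun -(chain_fwd w); exact: functor_idc.
- exact: (functor_comp _ (star_e e) e').
Defined.

Lemma chain_uptoP k w :
  exists f : functor (trunc S k) B, Inv f /\ forall x, chain_upto k w x = f k x.
Proof. by exists (sval (chain w)); split=> //; apply: svalP. Qed.
End Chain.

(** The lift of a generator is chosen inside the boundary already lifted; the
    invariant is that the functor built so far lifts [v]. *)
Lemma lift_star (C D : complex) (g : mor C D) (v : mor (star S) D) :
  (forall d : D 0, exists c, g 0 c = d) ->
  (forall n (x y : C n) (d : D n.+1), parallel x y ->
     src d = g n x -> tgt d = g n y ->
     exists c, [/\ src c = x, tgt c = y & g n.+1 c = d]) ->
  exists h : mor (star S) C, forall k x, g k (h k x) = v k x.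
Proof.
move=> lift0 liftS.
pose Inv k (f : functor (trunc S k) C) := forall x : star S k, g k (f k x) = v k x.
have start : exists f : functor (trunc S 0) C, Inv 0 f.
  pose phi x := sval (cid (lift0 (v 0 x))).
  have phiP x : g 0 (phi x) = v 0 x by rewrite /phi; case: cid.
  by exists (disc_functor phi) => x; apply: phiP.
have step k : within None k.+1 -> forall f, Inv k f ->
    exists f', Inv k.+1 f' /\ forall j (x : trunc S k j), f' j (fwd x) = f j x.
  move=> _ f hf; pose T := projT2 (stage S k).
  have phi_ex a : exists c, [/\ src c = f k (gsrc T a), tgt c = f k (gtgt T a) &
      g k.+1 c = v k.+1 (star_gen a)].
    apply: liftS.
    - by apply: functor_par; apply: gpar.
    - by rewrite -mor_src star_gen_src hf.
    - by rewrite -mor_tgt star_gen_tgt hf.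
  pose phi a := sval (cid (phi_ex a)).
  have phi1 a : src (phi a) = f k (gsrc T a) by rewrite /phi; case: cid => c [].
  have phi2 a : tgt (phi a) = f k (gtgt T a) by rewrite /phi; case: cid => c [].
  exists (ext_functor (gpar T) phi1 phi2); split=> //.
  apply: star_succ_ind => [a|c|p x y e hx hy].
  - rewrite ext_functor_gen /phi; by case: cid => c [].
  - rewrite (mor_idc v) -hf -mor_idc.
    by congr (g _ _); apply: functor_idc.
  - pose F := ext_functor (gpar T) phi1 phi2.
    have e1 := functor_e F (star_e e).
    transitivity (g _ (comp p (F _ x) (F _ y) e1)).
      by congr (g _ _); apply: functor_comp.
    rewrite (mor_comp v e (mor_e v e)) (mor_comp g e1 (mor_e g e1)).
    exact: comp_eq.
exists (mor_of_upto (chain_upto start step)) => k x.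
have [f [hf hH]] := chain_uptoP start step (k := k) isT.
exact: etrans (congr1 (g k) (hH x)) (hf x).
Qed.
End Star.

Lemma star_agree N S (D : complex) (f f' : mor_upto N (star S) D) :
  (forall w (a : gens0 S), f 0 w a = f' 0 w a) ->
  (forall k w (a : gens (projT2 (stage S k))),
     f k.+1 w (star_gen a) = f' k.+1 w (star_gen a)) ->
  forall k w x, f k w x = f' k w x.
Proof.
move=> h0 hS; elim=> [|k IH] w; first exact: h0.
apply: star_succ_ind => [a|c|p x y e hx hy]; first exact: hS.
- by rewrite !(upto_idc _ w (within_pred w)) IH.
- have e1 := upto_e f w e; have e2 := upto_e f' w e.
  by rewrite (upto_comp f w e e1) (upto_comp f' w e e2); apply: comp_eq.
Qed.

(** * Freeness of the complex on a globular set *)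

Section Glob.
Variable X : globular.

(** Transport along [E] identifies the generators of a tower that is only known
    to be equal to that of a globular set. *)
Definition next_gen n (C : ncat n) (T : tower C) (eta : X n -> C n)
    (eta_par : forall x y, parallel x y -> parallel (eta x) (eta y))
    (E : glob_tower eta_par = T) : X n.+1 -> gens T :=
  match E in _ = T return X n.+1 -> gens T with erefl => id end.

(** At every stage, the remaining tower is the one of the globular set, for some
    inclusion of the n-cells as generators.  The lemma is transparent, so that
    the inclusion chosen in dimension n+1 is visibly the one by new generators
    that [glob_tower] makes out of the inclusion in dimension n. *)
Lemma free_gens_exist n :
  {eta : X n -> trunc (glob_polygraph X) n n &
  {eta_par : forall x y, parallel x y -> parallel (eta x) (eta y) |
   glob_tower eta_par = projT2 (stage (glob_polygraph X) n)}}.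
Proof.
elim: n => [|n [eta [eta_par E]]].
  by exists id; exists (fun _ _ h => h).
exists (fun x => free_gen _ (next_gen E x)).
rewrite /trunc /=.
case: _ / E.
by exists (fun a b hab =>
  @free_gen_par _ _ _ _ _ (fun a => eta_par _ _ (par_src_tgt a)) a b
    (f_equal eta (proj1 hab)) (f_equal eta (proj2 hab))).
Defined.

(** The unit of the adjunction between globular sets and complexes. *)
Definition unit_gen n : X n -> free_on X n := projT1 (free_gens_exist n).

(** All that the universal property needs to know of [unit_gen]: it is a
    bijection onto the generators, compatible with their boundaries. *)
Lemma unit_genS n : exists c : X n.+1 -> gens (projT2 (stage (glob_polygraph X) n)),
  [/\ forall x, unit_gen x = star_gen (c x),
      forall x, gsrc _ (c x) = unit_gen (src x),
      forall x, gtgt _ (c x) = unit_gen (tgt x) &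
      bijective c].
Proof.
rewrite /unit_gen /=; case: (free_gens_exist n) => eta [eta_par E] /=.
exists (next_gen E); split=> //; rewrite /trunc in eta eta_par E *; destruct E => //.
by exists id.
Qed.

Lemma unit_gen_src n (x : X n.+1) : src (unit_gen x) = unit_gen (src x).
Proof. by have [c [-> <- _ _]] := unit_genS n; apply: star_gen_src. Qed.

Lemma unit_gen_tgt n (x : X n.+1) : tgt (unit_gen x) = unit_gen (tgt x).
Proof. by have [c [-> _ <- _]] := unit_genS n; apply: star_gen_tgt. Qed.

Lemma free_on_agree N (D : complex) (f f' : mor_upto N (free_on X) D) :
  (forall k w (x : X k), f k w (unit_gen x) = f' k w (unit_gen x)) ->
  forall k w x, f k w x = f' k w x.
Proof.
move=> h; apply: star_agree => [w|k w] a; first exact: (h 0 w a).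
have [c [c1 _ _ [d _ dK]]] := unit_genS k.
by rewrite -(dK a) -c1.
Qed.

Lemma free_on_extend N (D : complex) (e : forall k, within N k -> X k -> D k) :
  (forall k w w' (x : X k.+1), src (e k.+1 w x) = e k w' (src x)) ->
  (forall k w w' (x : X k.+1), tgt (e k.+1 w x) = e k w' (tgt x)) ->
  exists f : mor_upto N (free_on X) D,
    forall k w (x : X k), f k w (unit_gen x) = e k w x.
Proof.
move=> es et.
pose S := glob_polygraph X.
pose Inv k (f : functor (trunc S k) D) := forall w (x : X k), f k (unit_gen x) = e k w x.
have start : exists f : functor (trunc S 0) D, Inv 0 f.
  have w0 : within N 0 by case: (N).
  by exists (disc_functor (e 0 w0)) => w x; rewrite (bool_irrelevance w w0).
have step k : within N k.+1 -> forall f, Inv k f ->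
    exists f', Inv k.+1 f' /\ forall j (x : trunc S k j), f' j (fwd x) = f j x.
  move=> w f hf; have [c [c1 cs ct [d cK dK]]] := unit_genS k.
  pose phi a := e k.+1 w (d a).
  have phi1 a : src (phi a) = f k (gsrc (projT2 (stage S k)) a).
    by rewrite /phi (es _ _ (within_pred w)) -{2}(dK a) cs (hf (within_pred w)).
  have phi2 a : tgt (phi a) = f k (gtgt (projT2 (stage S k)) a).
    by rewrite /phi (et _ _ (within_pred w)) -{2}(dK a) ct (hf (within_pred w)).
  exists (ext_functor (gpar (projT2 (stage S k))) phi1 phi2); split=> // w' x.
  by rewrite c1 ext_functor_gen /phi cK (bool_irrelevance w w').
exists (chain_upto start step) => k w x.
by have [f [hf ->]] := chain_uptoP start step w; apply: hf.
Qed.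
End Glob.

(** * Cells as maps out of globes *)

Lemma par_sym (X : globular) m (x y : X m) : parallel x y -> parallel y x.
Proof. by case: m x y => [|m] x y //= [-> ->]. Qed.

Section Bounds.
Variable X : globular.

Definition bd (b : bool) k (x : X k.+1) : X k := if b then tgt x else src x.

(** Iterated source or target, down to any dimension [k <= m], with [ibd b x = x]
    when [k = m].  Unlike [isrc] and [itgt] it is indexed by [k] itself, as the
    cells of a globe are. *)
Fixpoint ibd b m : X m -> forall k, k < m.+1 -> X k :=
  match m return X m -> forall k, k < m.+1 -> X k with
  | 0 => fun x k h => eq_rect 0 X x k (@idtop_pf 0 k isT h)
  | m'.+1 => fun x k h =>
      match ltn_dec k m'.+1 with
      | left h' => ibd b (bd b x) h'
      | right h' => eq_rect m'.+1 X x k (idtop_pf h' h)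
      end
  end.

Lemma ibd_top b m (x : X m) h : ibd b x h = x.
Proof.
case: m x h => [|m] x h /=; first by rewrite (eq_irrelevance (idtop_pf _ _) erefl).
case: ltn_dec => h'; first by exfalso; rewrite ltnn in h'.
by rewrite (eq_irrelevance (idtop_pf _ _) erefl).
Qed.

Lemma ibd_low b m (x : X m.+1) k h h' : @ibd b m.+1 x k h = ibd b (bd b x) h'.
Proof.
rewrite /=; case: ltn_dec => h''; first by rewrite (bool_irrelevance h'' h').
by exfalso; rewrite h' in h''.
Qed.

Lemma par_bd b c m (x z : X m.+1) : parallel x z -> parallel (bd b x) (bd c z).
Proof.
case: m x z => [//|m] x z /= [hs ht].
by case: b c => [] [] /=; rewrite ?hs ?ht ?src_src ?tgt_src.
Qed.

(** Globularity: among the sides taken along an iterated boundary only the last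
    one matters, and parallel cells have the same iterated boundaries. *)
Lemma bd_ibd b c m (x z : X m) k h h' :
  parallel x z -> bd c (@ibd b m x k.+1 h) = @ibd c m z k h'.
Proof.
elim: m b x z h h' => [|m IH] b x z h h' hp; first by exfalso.
have hk : k < m.+1 by [].
rewrite (ibd_low _ _ _ hk); case: (ltnP k.+1 m.+1) => hk'.
  rewrite (ibd_low _ _ _ hk'); apply: IH.
  exact: par_bd.
have e : k = m by apply/eqP; rewrite eqn_leq; apply/andP; split.
subst k; rewrite !ibd_top {IH}; by case: hp; case: c.
Qed.
End Bounds.

Lemma mor_ibd (A B : complex) (g : mor A B) b m (x : A m) k (h : k < m.+1) :
  g _ (ibd b x h) = ibd b (g _ x) h.
Proof.
elim: m x k h => [|m IH] x k h /=; first by case: _ / idtop_pf.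
case: ltn_dec => h'; last by case: _ / idtop_pf.
by rewrite IH {IH}; case: b; rewrite /= ?mor_src ?mor_tgt.
Qed.

(** The value on the top cell is arbitrary: the iterated boundary of a cell in its
    own dimension is the cell itself on both sides. *)
Definition globe_side n k (c : globe_cell n k) : bool :=
  if c is globe_bd _ b _ then b else false.

Lemma globe_le n k (c : globe_cell n k) : k < n.+1.
Proof. by case: c => // j _ /ltnW. Qed.

Lemma globe_map (D : complex) n (d : D n) :
  exists v : mor (O_ n) D, forall k (c : globe_cell n k),
    v k (@unit_gen (globe n) k c) = ibd (globe_side c) d (globe_le c).
Proof.
have [||v hv] := @free_on_extend (globe n) None D
   (fun k _ (c : globe_cell n k) => ibd (globe_side c) d (globe_le c)).
- by move=> k _ _ c; apply: (@bd_ibd _ _ false); apply: par_refl.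
- by move=> k _ _ c; apply: (@bd_ibd _ _ true); apply: par_refl.
by exists (mor_of_upto v) => k c; apply: hv.
Qed.

(** Up to dimension m, the (m+1)-globe consists of the two m-cells bounding its
    top cell, with their common boundary. *)
Lemma globe_pair_map (C : complex) m (x y : C m) : parallel x y ->
  exists f : mor_upto (Some m) (O_ m.+1) C, forall k w (c : globe_cell m.+1 k),
    f k w (@unit_gen (globe m.+1) k c) =
    ibd (globe_side c) (if globe_side c then y else x) w.
Proof.
move=> xy; have yx := par_sym xy.
apply: (@free_on_extend (globe m.+1) (Some m) C
   (fun k w (c : globe_cell m.+1 k) =>
      ibd (globe_side c) (if globe_side c then y else x) w)) => k w w' c.
- apply: (@bd_ibd _ _ false); case: globe_side => //; exact: par_refl.
- apply: (@bd_ibd _ _ true); case: globe_side => //; exact: par_refl.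
Qed.

(** * The boundary of a globe *)

Section Degenerate.
Variables (C : complex) (m : nat).

(** Cells whose dimension can be lowered to m by removing identities.  The
    condition is hereditary on sources, as needed for closure under [src]. *)
Fixpoint degen k : C k -> Prop :=
  match k return C k -> Prop with
  | 0 => fun _ => True
  | k'.+1 => fun x => m <= k' -> x = @idc _ C k' isT (src x) /\ degen (src x)
  end.

Lemma degen_low k (x : C k) : k <= m -> degen x.
Proof. by case: k x => [|k] x //= h h'; move: (leq_trans h h'); rewrite ltnn. Qed.

Lemma degen_tgt k (x : C k.+1) : degen x -> degen (tgt x).
Proof.
case: (leqP m k) => h /=; last by move=> _; apply: degen_low; apply: ltnW.
by move=> /(_ h) [e dx]; rewrite e (tgt_idc (catP C)).
Qed.

Lemma degen_src k (x : C k.+1) : degen x -> degen (src x).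
Proof.
case: (leqP m k) => h /=; last by move=> _; apply: degen_low; apply: ltnW.
by move=> /(_ h) [].
Qed.

Lemma degen_idc k h (x : C k) : degen x -> degen (@idc _ C k h x).
Proof. by move=> dx /= _; rewrite (src_idc (catP C)); split=> //; apply: idc_eq. Qed.

Lemma idc_top_idc k h (a b : C k) e :
  comp (itop k) (@idc _ C k h a) (@idc _ C k h b) e = @idc _ C k h a.
Proof.
have hab : b = a.
  by move: e; rewrite /= (src_idc (catP C)) (tgt_idc (catP C)).
subst b; apply: (@comp_idr' _ C k.+1 (itop k)).
by rewrite /= (tgt_idc (catP C)).
Qed.

(** Two identities composable along their common dimension are equal and absorb
    each other; along a lower dimension their composite is the identity of a
    composite, whence the induction on the dimension. *)
Lemma degen_comp k (p : idx k) (x y : C k) e :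
  degen x -> degen y -> degen (comp p x y e).
Proof.
elim: k p x y e => [[]|k IH p] x y e dx dy /= h.
have [ex dsx] := dx h; have [ey dsy] := dy h.
case: p e => [p|] e; last first.
  rewrite (src_comp_top (catP C)); split=> //.
  move: e; rewrite ex ey => e; rewrite (src_idc (catP C)); exact: idc_top_idc.
have e1 : itgt p (src x) = isrc p (src y).
  by rewrite (itgt_par p (par_src_tgt x)).
rewrite (src_comp_up (catP C) e e1); split; last exact: IH.
move: e; rewrite {1 2}ex {1 2}ey => e; symmetry; exact: (idc_comp (catP C)).
Qed.

Lemma generated_degen k (x : C k) :
  generated (fun k _ => k < m.+1) x -> degen x.
Proof.
elim=> {k x} [k x h|k x _|k x _|k h x _|k p x y e _ dx _ dy].
- exact: degen_low.
- exact: degen_src.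
- exact: degen_tgt.
- exact: degen_idc.
- exact: degen_comp.
Qed.
End Degenerate.

Lemma dO_idc m k (x : dO m.+1 k.+1) : m <= k -> x = @idc _ (dO m.+1) k isT (src x).
Proof.
move=> h; apply: sig_eq => /=.
by have [] := generated_degen (svalP x) h.
Qed.

Lemma dO0_empty k (x : dO 0 k) : False.
Proof. by case: x => x; elim. Qed.

(** A complex with only identities above dimension m has, as far as morphisms are
    concerned, nothing above dimension m. *)
Section ExtendDegenerate.
Variables (B C : complex) (m : nat) (f : mor_upto (Some m) B C).
Hypothesis deg : forall k (x : B k.+1), m <= k -> x = @idc _ B k isT (src x).

Fixpoint degen_fun k : B k -> C k :=
  match k return B k -> C k with
  | 0 => f 0 (leq0n m)
  | k'.+1 => fun x =>
     match ltn_dec k' m with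
     | left h => f k'.+1 h x
     | right _ => @idc _ C k' isT (degen_fun (src x))
     end
  end.

Lemma degen_fun_low k (w : within (Some m) k) x : degen_fun x = f k w x.
Proof.
case: k w x => [|k] w x /=; first by rewrite (bool_irrelevance (leq0n m) w).
case: ltn_dec => h; first by rewrite (bool_irrelevance h w).
by exfalso; move: w h => /= ->.
Qed.

Lemma degen_fun_high k (x : B k.+1) : m <= k ->
  degen_fun x = @idc _ C k isT (degen_fun (src x)).
Proof. by move=> h /=; case: ltn_dec => // h'; exfalso; rewrite ltnNge h in h'. Qed.

Lemma degen_fun_src k (x : B k.+1) : degen_fun (src x) = src (degen_fun x).
Proof.
case: (leqP m k) => h; first by rewrite (degen_fun_high x h) (src_idc (catP C)).
by rewrite (degen_fun_low h) (degen_fun_low (ltnW h)) (upto_src f h).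
Qed.

Lemma degen_fun_tgt k (x : B k.+1) : degen_fun (tgt x) = tgt (degen_fun x).
Proof.
case: (leqP m k) => h; last first.
  by rewrite (degen_fun_low h) (degen_fun_low (ltnW h)) (upto_tgt f h).
rewrite (degen_fun_high x h) (tgt_idc (catP C)).
by rewrite {1}(deg x h) (tgt_idc (catP B)).
Qed.

Lemma degen_fun_idc k h (x : B k) : degen_fun (idc h x) = idc h (degen_fun x).
Proof.
case: (leqP m k) => hk.
  by rewrite (degen_fun_high _ hk) (src_idc (catP B)); apply: idc_eq.
by rewrite (degen_fun_low hk) (degen_fun_low (ltnW hk)); apply: upto_idc.
Qed.

Lemma degen_fun_comp k (p : idx k) (u v : B k) e e' :
  degen_fun (comp p u v e) = comp p (degen_fun u) (degen_fun v) e'.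
Proof.
elim: k p u v e e' => [[]|k IH p] u v e e'.
case: (leqP m k) => hk; last first.
  have e1 := upto_e f hk e.
  rewrite (degen_fun_low hk) (upto_comp f hk e e1).
  by apply: comp_eq; rewrite (degen_fun_low hk).
rewrite (degen_fun_high _ hk).
move: e'; rewrite (degen_fun_high u hk) (degen_fun_high v hk).
case: p e => [p|] e e'.
  have e1 : itgt p (src u) = isrc p (src v).
    by rewrite (itgt_par p (par_src_tgt u)).
  have e2 : itgt p (degen_fun (src u)) = isrc p (degen_fun (src v)).
    by move: e'; rewrite /= (src_idc (catP C)) (tgt_idc (catP C)).
  rewrite (src_comp_up (catP B) e e1).
  transitivity (@idc _ C k isT (comp p _ _ e2)); last exact: (idc_comp (catP C)).
  by apply: idc_eq; apply: IH.
by rewrite (src_comp_top (catP B)) idc_top_idc.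
Qed.

Definition degen_mor : mor B C :=
  Mor degen_fun_src degen_fun_tgt degen_fun_idc degen_fun_comp.
End ExtendDegenerate.

(** * Trivial fibrations lift cells *)

Section Fibration.
Variables (C D : complex) (g : mor C D).
Hypothesis gP : trivial_fibration g.

Lemma fib_lift0 (d : D 0) : exists c, g 0 c = d.
Proof.
have [v hv] := globe_map d.
have u : mor (dO 0) C.
  by apply: (@Mor (dO 0) C (fun k x => match dO0_empty x with end)) => k;
    do ?[move=> x; case: (dO0_empty x) | move=> ?].
have [|h [_ hg]] := gP (n := 0) (u := u) (v := v).
  by apply: mor_ext => k x; case: (dO0_empty x).
exists (h 0 (@unit_gen (globe 0) 0 (globe_top 0))).
have /= -> := congr1 (fun w : mor _ _ => w 0 (@unit_gen (globe 0) 0 (globe_top 0))) hg.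
by rewrite hv ibd_top.
Qed.

(** The cell is the value on the top cell of the globe of a lift whose restriction
    to the boundary is prescribed by [x] and [y]. *)
Lemma fib_liftS m (x y : C m) (d : D m.+1) :
  parallel x y -> src d = g m x -> tgt d = g m y ->
  exists c, [/\ src c = x, tgt c = y & g m.+1 c = d].
Proof.
move=> xy hs ht; have [v hv] := globe_map d; have [f hf] := globe_pair_map xy.
pose u := degen_mor (upto_pre f (i_ m.+1)) (@dO_idc m).
(* [g u = v i], first up to dimension m, where it follows from freeness. *)
have gf k w z : upto_post g f k w z = upto_of_mor (Some m) v k w z.
  apply: (@free_on_agree (globe m.+1) (Some m) D (upto_post g f)
    (upto_of_mor (Some m) v)) => {z} k' w' c.
  rewrite /= hf hv mor_ibd (ibd_low _ _ _ w').
  by case: globe_side; rewrite /= ?hs ?ht.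
have low k (w : within (Some m) k) (z : dO m.+1 k) : g k (u k z) = v k (sval z).
  apply: etrans (gf k w (sval z)); congr (g _ _); exact: degen_fun_low.
have [|h [hu hg]] := gP (n := m.+1) (u := u) (v := v).
  apply: mor_ext; elim=> [|k IH] z; first exact: (low 0 (leq0n m)).
  (* Above dimension m every cell of the boundary is an identity. *)
  case: (leqP m k) => hk; last exact: low.
  rewrite (dO_idc z hk) !mor_idc; congr idc; exact: IH.
pose cell b : globe_cell m.+1 m := globe_bd b (ltnSn m).
have hb b : h m (@unit_gen (globe m.+1) m (cell b)) = if b then y else x.
  pose z : dO m.+1 m := exist _ (@unit_gen (globe m.+1) m (cell b))
    (gen_base (A := fun k _ => k < m.+1) (ltnSn m)).
  have /= -> := congr1 (fun w : mor _ _ => w m z) hu.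
  by rewrite (degen_fun_low _ (leqnn m)) /= hf ibd_top.
pose top := @unit_gen (globe m.+1) m.+1 (globe_top m.+1).
exists (h m.+1 top); split.
- rewrite -mor_src unit_gen_src -(hb false); congr (h _ (unit_gen _)).
  by congr globe_bd; apply: bool_irrelevance.
- rewrite -mor_tgt unit_gen_tgt -(hb true); congr (h _ (unit_gen _)).
  by congr globe_bd; apply: bool_irrelevance.
have /= -> := congr1 (fun w : mor _ _ => w m.+1 top) hg.
by rewrite hv ibd_top.
Qed.
End Fibration.

(** * Cofibrancy of free complexes *)

Theorem proposition2 (S : polygraph) : cofibrant (star S).
Proof.
move=> C D g gP u v _.
have [h hP] := lift_star v (fib_lift0 gP) (fib_liftS gP).
exists h; split; first by apply: mor_ext => k [].
by apply: mor_ext => k x; apply: hP.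
Qed.
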